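(* The assignment $\mathcal D=\mathcal D_{\rm QLS}$ sending a weak QLS-algebra $(A,W)$ (with an arbitrarily chosen hyperplane $V\subset W$ complementary to $k\cdot e$) to the quadratic CDG-algebra $(B,d,h)$ constructed from $(A,W,V)$, and acting on morphisms as described in the context, is a fully faithful contravariant functor from the category $\mathcal{WQLS}$ of weak QLS-algebras to the category $\mathcal{QCDG}$ of quadratic CDG-algebras.
   Context: Conventions: $k$ is a fixed field; an algebra is an associative $k$-algebra with unit $e$; all graded and filtered algebras are locally finite-dimensional (so $W$ is finite-dimensional). $[a,b]=ab-(-1)^{\tilde a\tilde b}ba$ is the supercommutator. A derivation $d$ of degree $+1$ satisfies $d(ab)=d(a)b+(-1)^{\tilde a}a\,d(b)$. A quadratic algebra is a graded algebra of the form $T(V)/(I)$, $V$ in degree $1$, $I\subset V\otimes V$. Weak QLS-algebra: an algebra $A$ with a subspace $W\subset A$, $e\in W$, such that, for $V$ a hyperplane in $W$ complementary to $k\cdot e$, $T_n(V)\subset T(V)$ the subspace of elements of degree $\le n$, and $J=\ker(T(V)\to A)$: (1) $A$ is generated by $W$; (2) the two-sided ideal $J$ is generated by $J_2=J\cap T_2(V)$. (Independent of the choice of $V$.) Put $I=J_2\bmod T_1(V)\subset V\otimes V$. Morphisms in $\mathcal{WQLS}$ are algebra homomorphisms $F\colon A\to A'$ with $F(W)\subset W'$. CDG-algebra: a triple $\Psi=(B,d,h)$ with $B$ a graded algebra ($B^i=0$ for $i<0$), $d$ a derivation of degree $+1$, $h\in B^2$, such that $d^2=[h,\cdot\,]$,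 $d(h)=0$; it is quadratic if $B$ is. A morphism $(B,d,h)\to(B',d',h')$ is a pair $(f,\alpha)$ with $f\colon B\to B'$ a homomorphism of graded algebras and $\alpha\in B'^1$ such that $d'f(x)=f(dx)+[\alpha,f(x)]$ for all $x\in B$ and $h'=f(h)+d'\alpha-\alpha^2$. Composition: $(f,\alpha)\circ(g,\beta)=(f\circ g,\ \alpha+f(\beta))$; identity: $(\mathrm{id},0)$. $\mathcal{QCDG}$ is the category of quadratic CDG-algebras with these morphisms. $\mathcal D$ on objects: $B=T(V^* )/(I^\perp)$, where $I^\perp\subset V^*\otimes V^*$ is the annihilator of $I$ under $\langle\alpha\otimes\beta,v\otimes w\rangle=\alpha(v)\beta(w)$; so $B^1=V^*$, $B^2\simeq I^*$. There are unique $h\in I^*\simeq B^2$ and $\varphi\colon I\to V$ with $J_2=\{p+\varphi(p)+h(p):p\in I\}$. The map $\varphi^*\colon B^1\to B^2$ extends uniquely to a derivation $d$ of $B$ of degree $+1$, and $(B,d,h)$ is a CDG-algebra. $\mathcal D$ on morphisms: given $F\colon(A,W)\to(A',W')$ with chosen complements $V,V'$, write $F(v)=F_V(v)+b(v)e$ for $v\in V$, with $F_V\colon V\to V'$ linear and $b\in V^*$. Then $\mathcal D(F)\colon\mathcal D(A')\to\mathcal D(A)$ is the pair $(f,-b)$, where $f\colon B'\to B$ is the graded algebra homomorphism induced by $F_V^*\colon V'^*\to V^*$ and $-b\in V^*=B^1$. *)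

(* Defs.v *)
(* MathComp, with the free monoid algebras of multinomials *)
From HB Require Import structures.
From mathcomp Require Import all_boot all_order all_algebra.
From mathcomp Require Import finmap monalg.
From Stdlib Require Import FunctionalExtensionality ProofIrrelevance.
Set Implicit Arguments.
Unset Strict Implicit.
Unset Printing Implicit Defensive.
Import GRing.Theory.
Local Open Scope ring_scope.

Record category := Category {
  obj :> Type;
  mor : obj -> obj -> Type;
  idc : forall X, mor X X;
  comp : forall X Y Z, mor Y Z -> mor X Y -> mor X Z;
  comp1m : forall X Y (f : mor X Y), comp (idc Y) f = f;
  compm1 : forall X Y (f : mor X Y), comp f (idc X) = f;
  compmA : forall X Y Z T (h : mor Z T) (g : mor Y Z) (f : mor X Y),
    comp h (comp g f) = comp (comp h g) f }.

Arguments mor {c} _ _.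
Arguments idc {c} X.
Arguments comp {c X Y Z} _ _.

Record contra_functor (C D : category) (F0 : C -> D) := ContraFunctor {
  fmap :> forall X Y : C, mor X Y -> mor (F0 Y) (F0 X);
  fmap_id : forall X : C, fmap (idc X) = idc (F0 X);
  fmap_comp : forall (X Y Z : C) (g : mor Y Z) (f : mor X Y),
    fmap (comp g f) = comp (fmap f) (fmap g) }.

Arguments fmap {C D F0} _ {X Y} _.

Definition fully_faithful (C D : category) (F0 : C -> D)
    (F : contra_functor F0) : Prop :=
  forall X Y : C, bijective (fun f : mor X Y => fmap F f).

Section Algebras.
Variable k : fieldType.

Inductive ideal_gen (A : algType k) (S : A -> Prop) : A -> Prop :=
| ideal_gen0 : ideal_gen S 0
| ideal_genD x a s b : ideal_gen S x -> S s -> ideal_gen S (x + a * s * b).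

Inductive subalg_gen (A : algType k) (S : A -> Prop) : A -> Prop :=
| subalg_gen_mem x : S x -> subalg_gen S x
| subalg_gen1 : subalg_gen S 1
| subalg_genZD a x y :
    subalg_gen S x -> subalg_gen S y -> subalg_gen S (a *: x + y)
| subalg_genM x y : subalg_gen S x -> subalg_gen S y -> subalg_gen S (x * y).

Definition subspace (M : lmodType k) (S : M -> Prop) : Prop :=
  S 0 /\ forall a x y, S x -> S y -> S (a *: x + y).

Definition linear_on (M N : lmodType k) (S : M -> Prop) (f : M -> N) : Prop :=
  forall a x y, S x -> S y -> f (a *: x + y) = a *: f x + f y.

(* T(U), realised on the words in the basis (vbasis fullv) of U, the i-th basis
   vector being the letter i; [tensor_lift_unique] is its universal property. *)
Definition tensor (U : vectType k) : Type :=
  {malg k[{fmonom 'I_(\dim (fullv : {vspace U}))}]}.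

HB.instance Definition _ (U : vectType k) := GRing.Lalgebra.on (tensor U).

Fact tensor_scalerAr (U : vectType k) (a : k) (x y : tensor U) :
  a *: (x * y) = x * (a *: y).
Proof.
apply/malgP => m; rewrite mcoeffZ !mcoeffMr.
have le : (msupp (a *: y) `<=` msupp y)%fset by apply: msuppZ_le.
rewrite -!(mcoeffMr x) (mcoeffMrw _ (fsubset_refl _) le) mcoeffMr mulr_sumr.
apply: eq_bigr => i _; rewrite mulr_sumr; apply: eq_bigr => j _.
by rewrite mcoeffZ mulrCA mulrnAr.
Qed.

HB.instance Definition _ (U : vectType k) :=
  GRing.Lalgebra_isAlgebra.Build k (tensor U) (@tensor_scalerAr U).

Definition ebasis (U : vectType k) (i : 'I_(\dim (fullv : {vspace U}))) : U :=
  (vbasis fullv)`_i.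

(* the inclusion of U = T^1(U) *)
Definition tgen (U : vectType k) (u : U) : tensor U :=
  \sum_(i < \dim (fullv : {vspace U})) << coord (vbasis fullv) i u *g fmu i >>.

(* T^n(U) and T_n(U) *)
Definition tdeg (U : vectType k) (n : nat) (x : tensor U) : Prop :=
  forall m, m \in msupp x -> fdeg m = n.

Definition tfilt (U : vectType k) (n : nat) (x : tensor U) : Prop :=
  forall m, m \in msupp x -> (fdeg m <= n)%N.

(* the algebra homomorphism T(U) -> A extending a linear map f : U -> A *)
Definition tensor_lift (U : vectType k) (A : algType k) (f : U -> A)
    (x : tensor U) : A :=
  \sum_(m <- msupp x) x@_m *: \prod_(i <- (m : seq _)) f (ebasis i).

Lemma ebasis_sum (U : vectType k) (u : U) :
  u = \sum_(i < \dim (fullv : {vspace U})) coord (vbasis fullv) i u *: ebasis i.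
Proof. exact: coord_vbasis (memvf u). Qed.

Lemma coord_ebasis (U : vectType k) (i j : 'I_(\dim (fullv : {vspace U}))) :
  coord (vbasis fullv) i (ebasis j) = (i == j)%:R.
Proof. by rewrite coord_free ?(basis_free (vbasisP _)) // eq_sym. Qed.

Lemma tgen_ebasis (U : vectType k) (i : 'I_(\dim (fullv : {vspace U}))) :
  tgen (ebasis i) = << fmu i >>.
Proof.
rewrite /tgen (bigD1 i) //= coord_ebasis eqxx big1 ?addr0 // => j /negPf ne.
by rewrite coord_ebasis ne monalgU0.
Qed.

Lemma tgen_is_linear (U : vectType k) : linear (@tgen U).
Proof.
move=> a u v; rewrite /tgen scaler_sumr -big_split; apply: eq_bigr => i _ /=.
rewrite linearP /= monalgUD; congr (_ + _).
by apply/malgP => m; rewrite mcoeffZ !mcoeffU mulrnAr.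
Qed.

HB.instance Definition _ (U : vectType k) :=
  GRing.isLinear.Build k U (tensor U) _ (@tgen U) (@tgen_is_linear U).

Section Lift.
Variables (U : vectType k) (A : algType k) (f : {linear U -> A}).
Local Notation word m := (\prod_(i <- (m : seq _)) f (ebasis i)).

Let lift := mmap (in_alg A) (fun m : {fmonom _} => word m).

Let liftE x : tensor_lift f x = lift x.
Proof. by apply: eq_bigr => m _; rewrite mulr_algl. Qed.

Lemma tensor_lift_is_linear : linear (tensor_lift f).
Proof.
move=> a x y; rewrite !liftE /lift raddfD /=; congr (_ + _).
rewrite (mmapEw (msuppZ_le _ _)) mmapE scaler_sumr; apply: eq_bigr => m _ /=.
by rewrite mcoeffZ !mulr_algl scalerA.
Qed.

Lemma tensor_lift_is_monoid_morphism : monoid_morphism (tensor_lift f).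
Proof.
split=> [|x y]; rewrite !liftE /lift.
  by rewrite mmapU fm1 big_nil mulr1 /= scale1r.
rewrite malgME raddf_sum mulr_suml /=; apply: eq_bigr => i _.
rewrite raddf_sum mulr_sumr /=; apply: eq_bigr => j _.
by rewrite mmapU /= fmM big_cat /= !mulr_algl -scalerAl -scalerAr scalerA.
Qed.
End Lift.

HB.instance Definition _ (U : vectType k) (A : algType k) (f : {linear U -> A}) :=
  GRing.isLinear.Build k (tensor U) A _ (tensor_lift f)
    (tensor_lift_is_linear f).
HB.instance Definition _ (U : vectType k) (A : algType k) (f : {linear U -> A}) :=
  GRing.isMonoidMorphism.Build (tensor U) A (tensor_lift f)
    (tensor_lift_is_monoid_morphism f).

Lemma tensor_lift_gen (U : vectType k) (A : algType k) (f : {linear U -> A}) u :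
  tensor_lift f (tgen u) = f u.
Proof.
rewrite {2}(ebasis_sum u) !linear_sum; apply: eq_bigr => i _ /=.
rewrite linearZ /tensor_lift (big_fset_incl _ msuppU_le).
  by rewrite big_seq_fset1 mcoeffUU fmU big_seq1.
by move=> m _ /mcoeff_outdom ->; rewrite scale0r.
Qed.

Lemma tensor_lift_unique (U : vectType k) (A : algType k)
    (g : {lrmorphism tensor U -> A}) (f : {linear U -> A}) :
  (forall u, g (tgen u) = f u) -> g =1 tensor_lift f.
Proof.
move=> gf x; rewrite {1}[x]monalgE linear_sum; apply: eq_bigr => m _ /=.
have -> : << x@_m *g m >> = x@_m *: (<< m >> : tensor U).
  by apply/malgP => w; rewrite mcoeffZ !mcoeffU mulrnAr mulr1.
rewrite linearZ /=; congr (_ *: _); case: m => s.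
elim: s => [|i s IHs] /=.
  by rewrite big_nil -(rmorph1 g); congr (g << _ >>); rewrite /mone /= fmoneE.
rewrite big_cons -IHs -gf tgen_ebasis -rmorphM /=; congr (g _).
apply/malgP => w; rewrite -[<< fmu i >> * _]/(fgmul _ _) fgmulUU mulr1.
by congr (mcoeff _ << _ >>); apply/eqP; rewrite fmP fmM fmU.
Qed.
End Algebras.

Section Quadratic.
Variable k : fieldType.

Definition dual (U : vectType k) : vectType k := 'Hom(U, k^o).

(* The pairing of T^2(U^* ) with T^2(U) given by
   <a (x) b, v (x) w> = a(v) b(w); see [pairingE]. *)
Definition pairing (U : vectType k) (x : tensor (dual U)) (p : tensor U) : k :=
  \sum_a \sum_b \sum_i \sum_j
    x@_(mmul (fmu a) (fmu b)) * p@_(mmul (fmu i) (fmu j)) *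
      ((ebasis a : 'Hom(U, k^o)) (ebasis i) *
       (ebasis b : 'Hom(U, k^o)) (ebasis j)).

Lemma tgenM_coef (U : vectType k) (u v : U) i j :
  (tgen u * tgen v)@_(mmul (fmu i) (fmu j)) =
  coord (vbasis fullv) i u * coord (vbasis fullv) j v.
Proof.
rewrite /tgen mulr_suml raddf_sum (bigD1 i) //= [X in _ + X]big1 ?addr0.
  rewrite mulr_sumr raddf_sum (bigD1 j) //= [X in _ + X]big1 ?addr0.
    by rewrite -[_ * << _ *g _ >>]/(fgmul _ _) fgmulUU mcoeffUU.
  move=> l ne; rewrite -[_ * << _ *g _ >>]/(fgmul _ _) fgmulUU /= mcoeffU fmP !fmM !fmU.
  by rewrite /= !eqseq_cons (negPf ne) andbF.
move=> l ne; rewrite mulr_sumr raddf_sum big1 // => m _.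
rewrite -[_ * << _ *g _ >>]/(fgmul _ _) fgmulUU /= mcoeffU fmP !fmM !fmU.
by rewrite /= !eqseq_cons (negPf ne).
Qed.

Lemma pairingE (U : vectType k) (a b : 'Hom(U, k^o)) (v w : U) :
  pairing (tgen (a : dual U) * tgen (b : dual U)) (tgen v * tgen w) = a v * b w.
Proof.
have evE (c : 'Hom(U, k^o)) u : c u = \sum_l \sum_i
    coord (vbasis fullv) l (c : dual U) * coord (vbasis fullv) i u *
    (ebasis l : 'Hom(U, k^o)) (ebasis i).
  rewrite {1}(ebasis_sum (c : dual U)) sum_lfunE; apply: eq_bigr => l _.
  rewrite scale_lfunE {1}(ebasis_sum u) linear_sum scaler_sumr.
  by apply: eq_bigr => i _; rewrite linearZ /= /GRing.scale /= mulrA.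
rewrite (evE a) (evE b) [RHS]mulr_suml; apply: eq_bigr => l _.
rewrite [RHS]mulr_sumr; apply: eq_bigr => m _.
rewrite [RHS]mulr_suml; apply: eq_bigr => i _.
rewrite [RHS]mulr_sumr; apply: eq_bigr => j _.
by rewrite !tgenM_coef [RHS]mulrACA; congr (_ * _); rewrite mulrACA.
Qed.

Definition annihilator (U : vectType k) (I : tensor U -> Prop)
    (x : tensor (dual U)) : Prop :=
  tdeg 2 x /\ forall p, I p -> pairing x p = 0.

Record is_grading (B : algType k) (gr : nat -> B -> Prop) : Prop := IsGrading {
  gr_sub : forall n, subspace (gr n);
  gr_fin : forall n, exists s : seq B, forall x, gr n x ->
    exists c : nat -> k, x = \sum_(i < size s) c i *: s`_i;
  gr_1 : gr 0%N 1;
  gr_M : forall m n x y, gr m x -> gr n y -> gr (m + n)%N (x * y);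
  gr_span : forall x, exists N (c : nat -> B),
    (forall i, gr i (c i)) /\ x = \sum_(i < N) c i;
  gr_free : forall N (c : nat -> B), (forall i, gr i (c i)) ->
    \sum_(i < N) c i = 0 -> forall i, (i < N)%N -> c i = 0 }.

(* pi identifies the graded algebra B with T(U)/(I) *)
Definition presents (B : algType k) (gr : nat -> B -> Prop) (U : vectType k)
    (I : tensor U -> Prop) (pi : {lrmorphism tensor U -> B}) : Prop :=
  [/\ forall u, gr 1%N (pi (tgen u)),
      forall b, exists t, pi t = b
    & forall t, pi t = 0 <-> ideal_gen I t].

Definition is_quadratic (B : algType k) (gr : nat -> B -> Prop) : Prop :=
  exists (U : vectType k) (I : tensor U -> Prop)
         (pi : {lrmorphism tensor U -> B}),
    [/\ subspace I, forall t, I t -> tdeg 2 t & presents gr I pi].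

(* the supercommutator of elements of degrees m and n *)
Definition scomm (B : algType k) (m n : nat) (a b : B) : B :=
  a * b - (-1) ^+ (m * n) * (b * a).

Record cdg := MkCDG {
  cdg_alg :> algType k;
  cdg_gr : nat -> cdg_alg -> Prop;
  cdg_grP : is_grading cdg_gr;
  cdg_d : {linear cdg_alg -> cdg_alg};
  cdg_h : cdg_alg;
  cdg_d_gr : forall n x, cdg_gr n x -> cdg_gr n.+1 (cdg_d x);
  cdg_dM : forall n x y, cdg_gr n x ->
    cdg_d (x * y) = cdg_d x * y + (-1) ^+ n * (x * cdg_d y);
  cdg_h_gr : cdg_gr 2%N cdg_h;
  cdg_dd : forall n x, cdg_gr n x -> cdg_d (cdg_d x) = scomm 2 n cdg_h x;
  cdg_dh : cdg_d cdg_h = 0 }.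

Record cdg_hom (B B' : cdg) := MkCDGHom {
  ch_f : {lrmorphism B -> B'};
  ch_a : B';
  ch_f_gr : forall n x, cdg_gr n x -> cdg_gr n (ch_f x);
  ch_a_gr : cdg_gr 1%N ch_a;
  ch_d : forall n x, cdg_gr n x ->
    cdg_d B' (ch_f x) = ch_f (cdg_d B x) + scomm 1 n ch_a (ch_f x);
  ch_h : cdg_h B' = ch_f (cdg_h B) + cdg_d B' ch_a - ch_a ^+ 2 }.

Record qcdg := MkQCDG {
  qcdg_cdg :> cdg;
  qcdg_quad : is_quadratic (@cdg_gr qcdg_cdg) }.

(* For e != 0 this makes V a hyperplane. *)
Definition complementary (W : vectType k) (e : W) (V : {vspace W}) : Prop :=
  (V + <[e]> = fullv)%VS /\ (V :&: <[e]> = 0)%VS.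

Section Relations.
Variables (A : algType k) (W : vectType k) (inc : {linear W -> A}).
Variable V : {vspace W}.
Local Notation TV := (tensor (subvs_of V)).

Definition evalT : {lrmorphism TV -> A} :=
  tensor_lift (inc \o vsval : {linear subvs_of V -> A}).

(* J, J_2, and I = J_2 mod T_1(V) *)
Definition relJ (t : TV) : Prop := evalT t = 0.
Definition relJ2 (t : TV) : Prop := tfilt 2 t /\ relJ t.
Definition relI (p : TV) : Prop :=
  tdeg 2 p /\ exists2 q, relJ2 q & tfilt 1 (q - p).

End Relations.

Arguments relJ {A W} inc V t.
Arguments relJ2 {A W} inc V t.
Arguments relI {A W} inc V p.

(* The subspace W of A is given by its embedding wq_inc; e is wq_e. The
   condition wq_rel holds for all complements V as soon as it holds for one. *)
Record wqls := MkWQLS {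
  wq_alg :> algType k;
  wq_W : vectType k;
  wq_inc : {linear wq_W -> wq_alg};
  wq_inc_inj : injective wq_inc;
  wq_e : wq_W;
  wq_eE : wq_inc wq_e = 1;
  wq_gen : forall a, subalg_gen (fun x => exists w, wq_inc w = x) a;
  wq_rel : forall V, complementary wq_e V ->
    forall t : tensor (subvs_of V), relJ wq_inc V t -> ideal_gen (relJ2 wq_inc V) t }.

Record wqls_hom (A A' : wqls) := MkWQLSHom {
  wh_f : {lrmorphism A -> A'};
  wh_W : forall w, exists w', wh_f (wq_inc A w) = wq_inc A' w' }.

Lemma lrmorphism_ext (A B : algType k) (f g : {lrmorphism A -> B}) :
  f =1 g -> f = g.
Proof.
case: f g => [f cf] [g cg] /= /functional_extensionality fg.
rewrite /GRing.LRMorphism.sort /= in fg.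
case: g / fg cg => cg.
by congr GRing.LRMorphism.Pack; case: cf cg => [[?] [?] [?]] [[?] [?] [?]];
  congr GRing.LRMorphism.Class; congr (_ _); exact: proof_irrelevance.
Qed.

Lemma wqls_hom_ext (A A' : wqls) (F G : wqls_hom A A') :
  wh_f F =1 wh_f G -> F = G.
Proof.
case: F G => [f Wf] [g Wg] /= /lrmorphism_ext fg.
by case: g / fg Wg => Wg; congr MkWQLSHom; exact: proof_irrelevance.
Qed.

Lemma cdg_hom_ext (B B' : cdg) (f g : cdg_hom B B') :
  ch_f f =1 ch_f g -> ch_a f = ch_a g -> f = g.
Proof.
case: f g => [f a ? ? ? ?] [g b ? ? ? ?] /= /lrmorphism_ext fg ab.
by subst; congr MkCDGHom; exact: proof_irrelevance.
Qed.

Fact wqls_id_W (A : wqls) w :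
  exists w', (idfun : {lrmorphism A -> A}) (wq_inc A w) = wq_inc A w'.
Proof. by exists w. Qed.

Definition wqls_id (A : wqls) : wqls_hom A A := MkWQLSHom (@wqls_id_W A).

Section WQLSComp.
Variables (A B C : wqls) (G : wqls_hom B C) (F : wqls_hom A B).

Fact wqls_comp_W w : exists w',
  (wh_f G \o wh_f F : {lrmorphism A -> C}) (wq_inc A w) = wq_inc C w'.
Proof.
have [w1 /= ->] := wh_W F w.
by have [w2 ->] := wh_W G w1; exists w2.
Qed.

Definition wqls_comp : wqls_hom A C := MkWQLSHom wqls_comp_W.
End WQLSComp.

Definition WQLS : category.
refine (@Category wqls wqls_hom wqls_id wqls_comp _ _ _).
all: by move=> *; apply: wqls_hom_ext.
Defined.

Lemma scomm_rmorph (B B' : algType k) (f : {lrmorphism B -> B'}) m n a b :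
  f (scomm m n a b) = scomm m n (f a) (f b).
Proof. by rewrite /scomm rmorphB !rmorphM rmorphXn rmorphN1. Qed.

Lemma scommDl (B : algType k) m n (a a' b : B) :
  scomm m n (a + a') b = scomm m n a b + scomm m n a' b.
Proof. by rewrite /scomm mulrDl mulrDr mulrDr opprD addrACA. Qed.

Section CDGId.
Variable B : cdg.
Local Notation f := (idfun : {lrmorphism B -> B}).

Fact cdg_id_gr n x : cdg_gr n x -> cdg_gr n (f x). Proof. by []. Qed.

Fact cdg_id_a_gr : cdg_gr 1%N (0 : B).
Proof. by have [] := gr_sub (cdg_grP B) 1%N. Qed.

Fact cdg_id_d n x : cdg_gr n x ->
  cdg_d B (f x) = f (cdg_d B x) + scomm 1 n 0 (f x).
Proof. by rewrite /scomm mul0r !mulr0 subrr addr0. Qed.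

Fact cdg_id_h : cdg_h B = f (cdg_h B) + cdg_d B 0 - 0 ^+ 2.
Proof. by rewrite linear0 expr0n subr0 addr0. Qed.

Definition cdg_id : cdg_hom B B :=
  MkCDGHom cdg_id_gr cdg_id_a_gr cdg_id_d cdg_id_h.
End CDGId.

Section CDGComp.
Variables (A B C : cdg) (F : cdg_hom B C) (G : cdg_hom A B).
Local Notation f := (ch_f F).
Local Notation g := (ch_f G).
Local Notation fg := (f \o g : {lrmorphism A -> C}).
Local Notation c := (ch_a F + f (ch_a G)).

Fact cdg_comp_gr n x : cdg_gr n x -> cdg_gr n (fg x).
Proof. by move=> /(ch_f_gr G) /(ch_f_gr F). Qed.

Fact cdg_comp_a_gr : cdg_gr 1%N c.
Proof.
have [_ sub] := gr_sub (cdg_grP C) 1%N.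
by rewrite -[ch_a F]scale1r; apply: sub (ch_a_gr F) (ch_f_gr F (ch_a_gr G)).
Qed.

Fact cdg_comp_d n x : cdg_gr n x ->
  cdg_d C (fg x) = fg (cdg_d A x) + scomm 1 n c (fg x).
Proof.
move=> xn /=; rewrite (ch_d F (ch_f_gr G xn)) (ch_d G xn).
by rewrite rmorphD /= scomm_rmorph scommDl -addrA; congr (_ + _); rewrite addrC.
Qed.

Fact cdg_comp_h : cdg_h C = fg (cdg_h A) + cdg_d C c - c ^+ 2.
Proof.
rewrite (ch_h F) (ch_h G) /= !rmorphB rmorphD rmorphXn linearD /=.
rewrite (ch_d F (ch_a_gr G)) /scomm muln1 expr1 mulN1r opprK.
rewrite [(_ + _) ^+ 2]expr2 mulrDl !mulrDr -!expr2.
set a2 := ch_a F ^+ 2; set b2 := f _ ^+ 2.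
set ab := ch_a F * _; set ba := f _ * ch_a F.
apply: (addIr (a2 + ab + (ba + b2))); rewrite subrK.
rewrite [LHS](AC (5*(2*2)) ((1*(4*(2*(7*8))))*(5*6)*(3*9))) /=.
by rewrite !addNr !addr0.
Qed.

Definition cdg_comp : cdg_hom A C :=
  MkCDGHom cdg_comp_gr cdg_comp_a_gr cdg_comp_d cdg_comp_h.
End CDGComp.

Definition QCDG_hom (B B' : qcdg) : Type := cdg_hom B B'.

Definition QCDG : category.
refine (@Category qcdg QCDG_hom (fun B => cdg_id B)
  (fun A B C => @cdg_comp A B C) _ _ _).
- by move=> A B f; apply: cdg_hom_ext => //=; rewrite add0r.
- by move=> A B f; apply: cdg_hom_ext => //=; rewrite rmorph0 addr0.
- by move=> A B C D h g f; apply: cdg_hom_ext => //=; rewrite rmorphD addrA.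
Defined.

Definition hyperplane (A : wqls) : Type :=
  {V : {vspace wq_W A} | complementary (wq_e A) V}.

Definition hp_space (A : wqls) (V : hyperplane A) : vectType k :=
  subvs_of (sval V).

Definition hp_inc (A : wqls) (V : hyperplane A) (v : hp_space V) : A :=
  wq_inc A (vsval v).

Section Dual.
Variables (A : wqls) (V : hyperplane A).
Local Notation TV := (tensor (hp_space V)).
Local Notation TVd := (tensor (dual (hp_space V))).
Local Notation I := (relI (wq_inc A) (sval V)).

(* J_2 = {p + phi(p) + c(p) : p in I}, with phi : I -> V and c : I -> k linear *)
Definition is_phi_h (phi : TV -> hp_space V) (c : TV -> k) : Prop :=
  [/\ linear_on I phi, linear_on I (c : TV -> k^o)
    & forall q, relJ2 (wq_inc A) (sval V) q <->
        exists2 p, I p & q = p + tgen (phi p) + (c p)%:A].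

(* under B^2 = T^2(V^* )/I^perp = I^*, the element b is the functional g on I *)
Definition represents (B : cdg) (pi : {lrmorphism TVd -> B}) (b : B)
    (g : TV -> k) : Prop :=
  exists x, [/\ tdeg 2 x, pi x = b & forall p, I p -> pairing x p = g p].

(* The values of D at (A, W, V): a quadratic CDG-algebra (B, d, h) with an
   identification pi of B with T(V^* )/(I^perp) under which d restricts to phi^*
   on B^1 = V^* and h is c. They are unique up to a unique isomorphism
   compatible with pi. *)
Record qls_dual := MkQLSDual {
  qd_cdg :> qcdg;
  qd_pi : {lrmorphism TVd -> qd_cdg};
  qd_pres : presents (@cdg_gr qd_cdg) (annihilator I) qd_pi;
  qd_dh : exists phi c, [/\ is_phi_h phi c,
    forall xi : 'Hom(hp_space V, k^o),
      represents qd_pi (cdg_d qd_cdg (qd_pi (tgen (xi : dual _))))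
        (fun p => xi (phi p))
    & represents qd_pi (cdg_h qd_cdg) c] }.

End Dual.

(* D(F) = (f, -b) : D(A') -> D(A), where F(v) = F_V(v) + b(v)e on V and f is
   induced by the transpose of F_V *)
Definition is_dual_mor (A A' : wqls) (V : hyperplane A) (V' : hyperplane A')
    (D : qls_dual V) (D' : qls_dual V') (F : wqls_hom A A')
    (g : cdg_hom D' D) : Prop :=
  exists (FV : 'Hom(hp_space V, hp_space V')) (b : 'Hom(hp_space V, k^o)),
  [/\ forall v, wh_f F (hp_inc v) = hp_inc (FV v) + b v *: 1,
      forall xi : 'Hom(hp_space V', k^o),
        ch_f g (qd_pi D' (tgen (xi : dual _))) =
          qd_pi D (tgen ((xi \o FV)%VF : dual _))
    & ch_a g = - qd_pi D (tgen (b : dual _))].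

End Quadratic.

Arguments is_dual_mor {k A A' V V'} D D' F g.

(* Main.v *)
Require Import Defs.
From HB Require Import structures.
From mathcomp Require Import all_boot all_order all_algebra.
From mathcomp Require Import finmap monalg.
From Stdlib Require Import ClassicalEpsilon.

(** Write J_2 = {p + phi(p) + c(p) : p in I}.  Existence of the dual: the tensor
algebra on V^* carries a derivation d lifting phi^*, and everything about it is
tested against linear functionals L on degree 3 that vanish on the ideal of
I^perp.  Such an L is an element of (I (x) V) :&: (V (x) I).  Expanding it in A in
the two possible ways gives a relation in J_2, that is, an element Q of I for
which phi(Q) and c(Q) are known; since L o d is the pairing with Q, this yields
d(I^perp) = 0, d^2 = [h, -] and d(h) = 0 in B.

Full faithfulness: a linear map f : V -> V' and a functional b define the
homomorphism T(V) -> T(V') extending v |-> f(v) + b(v).  It maps J_2 into J_2'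
exactly when p |-> (f (x) f)(p) maps I into I' and intertwines phi and c up to
terms in b, and by double annihilators this is exactly the condition that the
transpose of f and -b define a morphism of CDG-algebras. *)

Set Implicit Arguments.
Unset Strict Implicit.
Unset Printing Implicit Defensive.
Import GRing.Theory.
Local Open Scope ring_scope.
Local Open Scope quotient_scope.

(** * Linear algebra *)

(** The obstacle is that [d] is not canonical on the tensor algebra of V^*: phi^* takes values in
    B^2 = I^*, and a lift to tensors of degree 2 is a choice. So d^2 = [h, -] and d(h) = 0 can be
    expected only modulo the ideal of I^perp, which [d] must itself be shown to preserve. By the
    Leibniz rule all three claims reduce to elements of degree 3: d(x) for x in I^perp, the defect
    of d^2 = [h, -] on a generator, and d(h). Degree 3 is finite-dimensional, which is why
    functionals suffice to test membership in the ideal there.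

    Expanding L in A replaces its factors from I by -(phi + c), which lowers the degree. The
    difference of the two expansions therefore has degree at most 2 and lies in J_2, not merely in
    J, so phi and c are determined on its leading part.

    The sign in (f, -b) arises because the substitution v |-> f(v) + b(v) gives phi' after f (x) f
    as f after phi plus terms in b, whereas a morphism of CDG-algebras gives d after g as g after d'
    plus a commutator: the terms in b change sides. *)

Section Subspaces.
Variable k : fieldType.
Implicit Type M N : lmodType k.

Lemma subspaceD M (S : M -> Prop) x y : subspace S -> S x -> S y -> S (x + y).
Proof. by move=> [_ sub] Sx Sy; rewrite -[x]scale1r; apply: sub. Qed.

Lemma subspaceZ M (S : M -> Prop) a x : subspace S -> S x -> S (a *: x).
Proof. by move=> [S0 sub] Sx; rewrite -[_ *: x]addr0; apply: sub. Qed.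

Lemma subspaceN M (S : M -> Prop) x : subspace S -> S x -> S (- x).
Proof. by rewrite -scaleN1r; apply: subspaceZ. Qed.

Lemma subspaceB M (S : M -> Prop) x y : subspace S -> S x -> S y -> S (x - y).
Proof. by move=> subS Sx Sy; apply: subspaceD => //; apply: subspaceN. Qed.

Lemma subspace_sum M (S : M -> Prop) (subS : subspace S)
    (I : Type) (r : seq I) (P : pred I) F :
  (forall i, P i -> S (F i)) -> S (\sum_(i <- r | P i) F i).
Proof.
move=> SF; apply: (big_ind S) => //; first by case: subS.
by move=> x y; apply: subspaceD.
Qed.

Lemma linear_on0 M N (S : M -> Prop) (f : M -> N) :
  subspace S -> linear_on S f -> f 0 = 0.
Proof.
move=> [S0 _] linf; have := linf 1 0 0 S0 S0; rewrite !scale1r addr0.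
by move/eqP; rewrite -subr_eq0 opprD addNKr oppr_eq0 => /eqP.
Qed.

Lemma linear_onD M N (S : M -> Prop) (f : M -> N) x y :
  linear_on S f -> S x -> S y -> f (x + y) = f x + f y.
Proof. by move=> linf Sx Sy; rewrite -[x]scale1r linf // !scale1r. Qed.

Lemma linear_onZ M N (S : M -> Prop) (f : M -> N) a x :
  subspace S -> linear_on S f -> S x -> f (a *: x) = a *: f x.
Proof.
move=> subS linf Sx; rewrite -[_ *: x]addr0 linf //; last by case: subS.
by rewrite (linear_on0 subS linf) addr0.
Qed.

Lemma linear_on_sum M N (S : M -> Prop) (f : M -> N) (I : Type) (r : seq I) F :
  subspace S -> linear_on S f -> (forall i, S (F i)) ->
  f (\sum_(i <- r) F i) = \sum_(i <- r) f (F i).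
Proof.
move=> subS linf SF; elim: r => [|i r IHr].
  by rewrite !big_nil (linear_on0 subS linf).
by rewrite !big_cons (linear_onD linf) ?IHr //; apply: subspace_sum.
Qed.

Lemma kernel_subspace M N (f : {linear M -> N}) : subspace (fun x => f x = 0).
Proof.
split=> [|a x y fx fy]; first exact: linear0.
by rewrite linearP fx fy scaler0 addr0.
Qed.

Lemma equalizer_subspace M N (f g : {linear M -> N}) :
  subspace (fun x => f x = g x).
Proof.
by split=> [|a x y fx fy]; [rewrite !linear0 | rewrite !linearP fx fy].
Qed.

(* A maximal family of independent rows in S spans it. *)
Lemma subspace_rowspace n (S : 'rV[k]_n -> Prop) : subspace S ->
  exists r (M : 'M[k]_(r, n)),
    row_free M /\ forall x, S x <-> (x <= M)%MS.
Proof.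
move=> subS.
have SM r (M : 'M_(r, n)) : (forall i, S (row i M)) ->
    forall x, (x <= M)%MS -> S x.
  move=> rowM x /submxP [D ->]; rewrite mulmx_sum_row.
  by apply: subspace_sum => // i _; apply: subspaceZ.
suff ext m r (M : 'M_(r, n)) : (n - r < m)%N -> row_free M ->
    (forall i, S (row i M)) ->
    exists r (M : 'M[k]_(r, n)),
      row_free M /\ forall x, S x <-> (x <= M)%MS.
  apply: (ext n.+1 0%N 0); rewrite ?subn0 //; last by case.
  by rewrite /row_free mxrank0.
elim: m r M => // m IHm r M nrm freeM rowM.
case: (classic (exists2 x, S x & ~~ (x <= M)%MS)) => [[x Sx nMx]|allM]; last first.
  exists r, M; split=> // x; split=> [Sx|]; last exact: SM.
  by apply/negPn/negP => nMx; case: allM; exists x.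
have freex : row_free (col_mx x M).
  rewrite /row_free -addsmxE addsmxC eqn_leq; apply/andP; split.
    rewrite (leq_trans (mxrank_adds_leqif _ _)) // (eqP freeM) addnC.
    by rewrite leq_add2r rank_leq_row.
  have ltM : (M < M + x)%MS.
    by rewrite ltmxE addsmxSl addsmx_sub submx_refl.
  by move: (rank_ltmx ltM); rewrite (eqP freeM) add1n.
have ltrn : (r < n)%N.
  by have := rank_leq_col (col_mx x M); rewrite (eqP freex).
apply: (IHm _ _ _ freex) => [|i].
  by rewrite add1n subnS; move: ltrn nrm; rewrite -subn_gt0; case: (n - r)%N.
case: (splitP i) => j def_i.
  by rewrite (_ : i = lshift r j) ?rowKu ?row_id //; apply: val_inj.
by rewrite (_ : i = rshift 1 j) ?rowKd //; apply: val_inj.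
Qed.

Section Families.
Variables (M : lmodType k) (S : M -> Prop) (J : finType) (e : J -> M).
Hypothesis subS : subspace S.
Local Notation comb s := (\sum_j s j *: e j).

Let vec (v : 'rV[k]_#|J|) j := v 0 (enum_rank j).
Let row_of (s : J -> k) : 'rV[k]_#|J| := \row_i s (enum_val i).

Let vecK s : vec (row_of s) =1 s.
Proof. by move=> j; rewrite /vec mxE enum_rankK. Qed.

Let combK s : comb (vec (row_of s)) = comb s.
Proof. by apply: eq_bigr => j _; rewrite vecK. Qed.

Let vec_sub : subspace (fun v => S (comb (vec v))).
Proof.
split=> [|a x y Sx Sy].
  by rewrite big1 => [|j _]; [case: subS | rewrite /vec mxE scale0r].
rewrite (_ : comb _ = a *: comb (vec x) + comb (vec y)); first exact: (proj2 subS).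
rewrite scaler_sumr -big_split; apply: eq_bigr => j _ /=.
by rewrite /vec !mxE scalerDl scalerA.
Qed.

Let row_ofM s (y : 'cV[k]_#|J|) :
  (row_of s *m y) 0 0 = \sum_j s j * y (enum_rank j) 0.
Proof.
rewrite mxE (reindex (@enum_rank J)) /=; last exact/onW_bij/enum_rank_bij.
by apply: eq_bigr => j _; rewrite mxE enum_rankK.
Qed.

(** The coefficient vectors whose combination lies in [S] form the row space of a row-free matrix
    [B]. If [c] lists the values of [g] on the rows of [B], then [pinvmx B *m c] solves
    [B *m y = c], since [pinvmx B] is a right inverse of [B]. *)
Lemma functional_extension (g : M -> k) : linear_on S (g : M -> k^o) ->
  exists y : J -> k,
    forall s : J -> k, S (comb s) -> g (comb s) = \sum_j s j * y j.
Proof.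
move=> ling; have [r [B [freeB SB]]] := subspace_rowspace vec_sub.
pose c := \col_i (g (comb (vec (row i B)))).
exists (fun j => (pinvmx B *m c) (enum_rank j) 0) => s Ss.
have /SB /submxP[D sD] : S (comb (vec (row_of s))) by rewrite combK.
rewrite -row_ofM sD -mulmxA [B *m _]mulmxA mulmxVp // mul1mx.
rewrite -combK sD mxE.
have SBi i : S (comb (vec (row i B))) by apply/SB/row_sub.
rewrite (_ : comb _ = \sum_i D 0 i *: comb (vec (row i B))).
  rewrite (linear_on_sum _ subS ling) => [|i]; last exact: subspaceZ.
  by apply: eq_bigr => i _; rewrite (linear_onZ _ subS ling) // mxE.
under [RHS]eq_bigr => i _ do rewrite scaler_sumr.
rewrite exchange_big; apply: eq_bigr => j _ /=.
rewrite /vec mxE scaler_suml; apply: eq_bigr => i _.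
by rewrite mxE scalerA.
Qed.

(** The columns of [cokermx B] are functionals that cut out the row space of [B]; testing [x]
    against them already decides membership. *)
Lemma double_annihilator (x : J -> k) :
  (forall y : J -> k, (forall s : J -> k, S (comb s) -> \sum_j s j * y j = 0) ->
     \sum_j x j * y j = 0) ->
  S (comb x).
Proof.
move=> annx; have [r [B [_ SB]]] := subspace_rowspace vec_sub.
rewrite -combK; apply/SB; rewrite submxE; apply/eqP/rowP => i.
have colE v : (v *m cokermx B) 0 i = (v *m col i (cokermx B)) 0 0.
  by rewrite colE mulmxA -colE [in RHS]mxE.
rewrite colE row_ofM mxE; apply: annx => s Ss.
rewrite -row_ofM -colE.
have /SB : S (comb (vec (row_of s))) by rewrite combK.
by rewrite submxE => /eqP ->; rewrite mxE.
Qed.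

End Families.
End Subspaces.

(** * Ideals and quotient algebras *)

Section Ideals.
Variables (k : fieldType) (A : algType k) (S : A -> Prop).

Lemma ideal_genDr x y : ideal_gen S x -> ideal_gen S y -> ideal_gen S (x + y).
Proof.
move=> Sx; elim=> [|z a s b _ IHz Ss]; first by rewrite addr0.
by rewrite addrA; constructor.
Qed.

Lemma ideal_gen_in a s b : S s -> ideal_gen S (a * s * b).
Proof. by move=> Ss; rewrite -[_ * b]add0r; do 2?constructor. Qed.

Lemma ideal_gen_mem s : S s -> ideal_gen S s.
Proof. by move=> Ss; rewrite -[s]mulr1 -[s]mul1r; apply: ideal_gen_in. Qed.

Lemma ideal_genMl c x : ideal_gen S x -> ideal_gen S (c * x).
Proof.
elim=> [|z a s b _ IHz Ss]; first by rewrite mulr0; constructor.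
by rewrite mulrDr !mulrA; constructor.
Qed.

Lemma ideal_genMr c x : ideal_gen S x -> ideal_gen S (x * c).
Proof.
elim=> [|z a s b _ IHz Ss]; first by rewrite mul0r; constructor.
by rewrite mulrDl -mulrA; constructor.
Qed.

Lemma ideal_gen_subspace : subspace (ideal_gen S).
Proof.
split=> [|a x y Sx Sy]; first by constructor.
by apply: ideal_genDr => //; rewrite -mulr_algl; apply: ideal_genMl.
Qed.

Lemma ideal_gen_min (P : A -> Prop) :
  P 0 -> (forall x y, P x -> P y -> P (x + y)) ->
  (forall a s b, S s -> P (a * s * b)) ->
  forall x, ideal_gen S x -> P x.
Proof. by move=> P0 PD PS x; elim=> // y a s b _ Py Ss; apply/PD/PS. Qed.

Lemma ideal_gen_ker (B : algType k) (f : {lrmorphism A -> B}) x :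
  (forall s, S s -> f s = 0) -> ideal_gen S x -> f x = 0.
Proof.
move=> fS; elim/ideal_gen_min => [|y z fy fz|a s b /fS fs]; first exact: raddf0.
  by rewrite raddfD /= fy fz addr0.
by rewrite !rmorphM /= fs mulr0 mul0r.
Qed.
End Ideals.

Section Descent.
Variables (k : fieldType) (A B : algType k) (pi : {lrmorphism A -> B}).
Hypothesis pi_surj : forall b, exists a, pi a = b.

(** A section [r] of [pi] obtained by choice need not be linear, but [g \o r] is: two preimages of
    one element differ by an element of the kernel of [pi], which [g] kills. *)
Lemma descend_linear (C : lmodType k) (g : {linear A -> C}) :
  (forall a, pi a = 0 -> g a = 0) ->
  exists h : {linear B -> C}, forall a, h (pi a) = g a.
Proof.
move=> gker; pose r b := sval (constructive_indefinite_description _ (pi_surj b)).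
have rK b : pi (r b) = b.
  by rewrite /r; case: constructive_indefinite_description.
have gr a a' : pi a = pi a' -> g a = g a'.
  move=> eqa; apply: subr0_eq; rewrite -raddfB; apply: gker.
  by rewrite raddfB /= eqa subrr.
have h_lin : linear (g \o r).
  move=> a x y /=; rewrite -linearP; apply: gr.
  by rewrite linearP /= !rK.
pose h := HB.pack_for {linear B -> C} (g \o r)
  (GRing.isLinear.Build _ _ _ _ (g \o r) h_lin).
by exists h => a; apply: gr; rewrite rK.
Qed.

Lemma descend_lrmorphism (C : algType k) (g : {lrmorphism A -> C}) :
  (forall a, pi a = 0 -> g a = 0) ->
  exists h : {lrmorphism B -> C}, forall a, h (pi a) = g a.
Proof.
move=> /(descend_linear) [h hE].
have h_mul : monoid_morphism h.
  split=> [|x y]; first by rewrite -(rmorph1 pi) hE rmorph1.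
  have [a <-] := pi_surj x; have [b <-] := pi_surj y.
  by rewrite -rmorphM !hE rmorphM.
pose h' := HB.pack_for {lrmorphism B -> C} (h : B -> C) (GRing.Linear.class h)
  (GRing.isMonoidMorphism.Build _ _ (h : B -> C) h_mul).
by exists h' => a; rewrite -hE.
Qed.
End Descent.

Section Quotient.
Variable k : fieldType.

(** Algebras are nonzero here; [proper_one] supplies [1 != 0] in the quotient. *)
Record proper_ideal (A : algType k) := ProperIdeal {
  proper_mem :> A -> Prop;
  proper_sub : subspace proper_mem;
  proper_mull : forall a x, proper_mem x -> proper_mem (a * x);
  proper_mulr : forall a x, proper_mem x -> proper_mem (x * a);
  proper_one : ~ proper_mem 1 }.

Variables (A : algType k) (I : proper_ideal A).

(** The quotient type is built from a boolean relation, whereas membership in the ideal is an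
    arbitrary proposition; excluded middle bridges the two. *)
Definition ideal_eq (x y : A) : bool :=
  if excluded_middle_informative (I (x - y)) then true else false.

Lemma ideal_eqP x y : reflect (I (x - y)) (ideal_eq x y).
Proof. by rewrite /ideal_eq; case: excluded_middle_informative; constructor. Qed.

Lemma ideal_eq_refl : reflexive ideal_eq.
Proof. by move=> x; apply/ideal_eqP; rewrite subrr; case: (proper_sub I). Qed.

Lemma ideal_eq_sym : symmetric ideal_eq.
Proof.
by move=> x y; apply/ideal_eqP/ideal_eqP => /(subspaceN (proper_sub I));
  rewrite opprB.
Qed.

Lemma ideal_eq_trans : transitive ideal_eq.
Proof.
move=> y x z /ideal_eqP Ixy /ideal_eqP Iyz; apply/ideal_eqP.
by rewrite -(subrK y x) -addrA; apply: subspaceD => //; apply: proper_sub.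
Qed.

Canonical ideal_equiv :=
  EquivRel ideal_eq ideal_eq_refl ideal_eq_sym ideal_eq_trans.

Definition ideal_quot := {eq_quot ideal_equiv}.
HB.instance Definition _ := Choice.on ideal_quot.
HB.instance Definition _ := EqQuotient.on ideal_quot.

Local Notation "\p x" := (\pi_ideal_quot x) (at level 10).

Lemma quot_eqP x y : \p x = \p y <-> I (x - y).
Proof.
split=> [/eqquotP /ideal_eqP //|Ixy].
by apply/eqquotP/ideal_eqP.
Qed.

(* Locked so that patterns in \p do not match through the operations. *)
Definition quot_add (x y : ideal_quot) := locked (\p (repr x + repr y)).
Definition quot_opp (x : ideal_quot) := locked (\p (- repr x)).
Definition quot_mul (x y : ideal_quot) := locked (\p (repr x * repr y)).
Definition quot_scale a (x : ideal_quot) := locked (\p (a *: repr x)).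

Let reprI x : I (repr (\p x) - x).
Proof. by apply/quot_eqP; rewrite reprK. Qed.

Let addE x y : quot_add (\p x) (\p y) = \p (x + y).
Proof.
rewrite /quot_add -lock; apply/quot_eqP; rewrite opprD addrACA.
by apply: subspaceD; [apply: proper_sub | apply: reprI | apply: reprI].
Qed.

Let oppE x : quot_opp (\p x) = \p (- x).
Proof.
rewrite /quot_opp -lock; apply/quot_eqP; rewrite -opprD.
by apply: (subspaceN (proper_sub I)); apply: reprI.
Qed.

Let mulE x y : quot_mul (\p x) (\p y) = \p (x * y).
Proof.
rewrite /quot_mul -lock; apply/quot_eqP; set rx := repr _; set ry := repr _.
rewrite -(subrK (rx * y) (rx * ry)) -mulrBr -addrA -mulrBl.
apply: (subspaceD (proper_sub I)); first exact/proper_mull/reprI.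
exact/proper_mulr/reprI.
Qed.

Let scaleE a x : quot_scale a (\p x) = \p (a *: x).
Proof.
rewrite /quot_scale -lock; apply/quot_eqP; rewrite -scalerBr.
by apply: (subspaceZ _ (proper_sub I)); apply: reprI.
Qed.

Let addA : associative quot_add.
Proof. by move=> x y z; rewrite -[x]reprK -[y]reprK -[z]reprK !addE addrA. Qed.
Let addC : commutative quot_add.
Proof. by move=> x y; rewrite -[x]reprK -[y]reprK !addE addrC. Qed.
Let add0 : left_id (\p 0) quot_add.
Proof. by move=> x; rewrite -[x]reprK addE add0r. Qed.
Let addN : left_inverse (\p 0) quot_opp quot_add.
Proof. by move=> x; rewrite -[x]reprK oppE addE addNr. Qed.

HB.instance Definition _ := GRing.isZmodule.Build ideal_quot addA addC add0 addN.

Let piD x y : \p x + \p y = \p (x + y) :> ideal_quot := addE x y.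

Let mulA : associative quot_mul.
Proof. by move=> x y z; rewrite -[x]reprK -[y]reprK -[z]reprK !mulE mulrA. Qed.
Let mul1 : left_id (\p 1) quot_mul.
Proof. by move=> x; rewrite -[x]reprK mulE mul1r. Qed.
Let mulq1 : right_id (\p 1) quot_mul.
Proof. by move=> x; rewrite -[x]reprK mulE mulr1. Qed.
Let mulDl : left_distributive quot_mul quot_add.
Proof.
by move=> x y z; rewrite -[x]reprK -[y]reprK -[z]reprK !(addE, mulE) mulrDl.
Qed.
Let mulDr : right_distributive quot_mul quot_add.
Proof.
by move=> x y z; rewrite -[x]reprK -[y]reprK -[z]reprK !(addE, mulE) mulrDr.
Qed.
Let quot1_neq0 : \p 1 != \p 0.
Proof. by apply/eqP => /quot_eqP; rewrite subr0; apply: proper_one. Qed.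

HB.instance Definition _ := GRing.Zmodule_isNzRing.Build ideal_quot
  mulA mul1 mulq1 mulDl mulDr quot1_neq0.

Let piM x y : \p x * \p y = \p (x * y) :> ideal_quot := mulE x y.

Let scaleA a b x : quot_scale a (quot_scale b x) = quot_scale (a * b) x.
Proof. by rewrite -[x]reprK !scaleE scalerA. Qed.
Let scale1 : left_id 1 quot_scale.
Proof. by move=> x; rewrite -[x]reprK scaleE scale1r. Qed.
Let scaleDr : right_distributive quot_scale +%R.
Proof.
by move=> a x y; rewrite -[x]reprK -[y]reprK !(piD, scaleE) scalerDr.
Qed.
Let scaleDl x : {morph quot_scale^~ x : a b / a + b}.
Proof. by move=> a b; rewrite -[x]reprK !(piD, scaleE) scalerDl. Qed.

HB.instance Definition _ := GRing.Zmodule_isLmodule.Build k ideal_quot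
  scaleA scale1 scaleDr scaleDl.

Let piZ a x : a *: \p x = \p (a *: x) :> ideal_quot := scaleE a x.

Let scaleAl a (x y : ideal_quot) : a *: (x * y) = (a *: x) * y.
Proof.
by rewrite -[x]reprK -[y]reprK !(piM, piZ) scalerAl.
Qed.

HB.instance Definition _ := GRing.Lmodule_isLalgebra.Build k ideal_quot scaleAl.

Let scaleAr a (x y : ideal_quot) : a *: (x * y) = x * (a *: y).
Proof.
by rewrite -[x]reprK -[y]reprK !(piM, piZ) scalerAr.
Qed.

HB.instance Definition _ := GRing.Lalgebra_isAlgebra.Build k ideal_quot scaleAr.

Definition quot_proj (x : A) : ideal_quot := \p x.

Let quot_proj_linear : linear quot_proj.
Proof. by move=> a x y; rewrite /quot_proj -piD -piZ. Qed.

Let quot_proj_mul : monoid_morphism quot_proj.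
Proof. by split=> // x y; rewrite /quot_proj -piM. Qed.

HB.instance Definition _ :=
  GRing.isLinear.Build k A ideal_quot _ quot_proj quot_proj_linear.
HB.instance Definition _ :=
  GRing.isMonoidMorphism.Build A ideal_quot quot_proj quot_proj_mul.
End Quotient.

Lemma quotient_algebra (k : fieldType) (A : algType k) (S : A -> Prop) :
  ~ ideal_gen S 1 ->
  exists (B : algType k) (pi : {lrmorphism A -> B}),
    (forall b, exists a, pi a = b) /\ forall a, pi a = 0 <-> ideal_gen S a.
Proof.
move=> S1; pose I := ProperIdeal (ideal_gen_subspace S) (ideal_genMl (S := S))
  (ideal_genMr (S := S)) S1.
exists (ideal_quot I), (quot_proj I : {lrmorphism _ -> _}); split=> [b|a].
  by exists (repr b); apply: reprK.
by rewrite -[a in ideal_gen S a]subr0; apply: (quot_eqP I).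
Qed.

(** * The tensor algebra *)

Section TwistedLeibniz.
Variables (k : fieldType) (A B : algType k) (pi : {lrmorphism A -> B}).
Variables (D : {linear A -> B}) (s : {lrmorphism A -> A}).

Lemma leibniz_gen_subspace (g : A) (d : B) :
  subspace (fun x => D (g * x) = d * pi x - pi g * D x).
Proof.
split=> [|c x y Dx Dy]; first by rewrite mulr0 rmorph0 !linear0 !mulr0 subr0.
rewrite mulrDr -scalerAr !linearP /= Dx Dy !mulrDr -!scalerAr.
by rewrite scalerBr opprD addrACA.
Qed.

Lemma leibniz_subspace :
  subspace (fun x => forall y, D (x * y) = D x * pi y + pi (s x) * D y).
Proof.
split=> [y|a x x' IH IH' y]; first by rewrite mul0r !linear0 !mul0r addr0.
rewrite mulrDl -scalerAl !linearP /= IH IH' !mulrDl -!scalerAl.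
by rewrite scalerDr addrACA.
Qed.

(** Inductive step along words: the rule for left multiplication by the odd element [g] carries the
    twisted Leibniz rule from [x] to [g * x]. *)
Lemma leibniz_gen_mul (g : A) (d : B) x : s g = - g ->
  (forall z, D (g * z) = d * pi z - pi g * D z) ->
  (forall y, D (x * y) = D x * pi y + pi (s x) * D y) ->
  forall y, D (g * x * y) = D (g * x) * pi y + pi (s (g * x)) * D y.
Proof.
move=> sg Dg Dx y; rewrite -mulrA !Dg Dx !rmorphM /= sg rmorphN mulrDr opprD.
by rewrite addrA mulrBl !mulrA !mulNr.
Qed.
End TwistedLeibniz.

Section TensorAlgebra.
Variables (k : fieldType) (U : vectType k).
Local Notation T := (tensor U).
Local Notation letter := 'I_(\dim (fullv : {vspace U})).
Local Notation e := (@ebasis k U).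

Definition word (s : seq letter) : T := << FMonom s >>.

Lemma coef_word s m : (word s)@_m = ((m : seq _) == s)%:R.
Proof. by rewrite mcoeffU fmP eq_sym. Qed.

Lemma word0 : word [::] = 1.
Proof. by rewrite /word -fmoneE. Qed.

Lemma word_cons i s : word (i :: s) = tgen (e i) * word s.
Proof.
rewrite tgen_ebasis -[RHS]/(fgmul _ _) fgmulUU mulr1.
by congr (mkmalgU _ _); apply/eqP; rewrite fmP fmM fmU.
Qed.

Lemma ebasis_ext (M : lmodType k) (f g : {linear U -> M}) :
  (forall i, f (e i) = g (e i)) -> f =1 g.
Proof.
move=> eq_fg u; rewrite (ebasis_sum u) !linear_sum; apply: eq_bigr => i _.
by rewrite !linearZ eq_fg.
Qed.

Lemma word2 i j : word [:: i; j] = tgen (e i) * tgen (e j).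
Proof. rewrite word_cons; congr (_ * _); rewrite word_cons word0; apply: mulr1. Qed.

Lemma tensorE (x : T) : x = \sum_(m <- msupp x) x@_m *: word m.
Proof.
rewrite {1}[x]monalgE; apply: eq_bigr => m _; apply/malgP => w.
by rewrite mcoeffZ coef_word mcoeffU fmP eq_sym mulr_natr.
Qed.

(** Common form of [tdeg], [tfilt] and lower bounds on the degree. Stated through vanishing
    coefficients, it is visibly stable under linear combinations. *)
Definition tsupp (P : pred nat) (x : T) : Prop :=
  forall m, ~~ P (fdeg m) -> x@_m = 0.

Lemma tsuppP (P : pred nat) x :
  tsupp P x <-> forall m, m \in msupp x -> P (fdeg m).
Proof.
split=> suppx m; last by apply: contraNeq; rewrite mcoeff_neq0 => /suppx.
by rewrite -mcoeff_neq0; apply: contraR => /suppx ->.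
Qed.

Lemma tdegE n x : tdeg n x <-> tsupp (pred1 n) x.
Proof. by rewrite tsuppP; split=> degx m /degx /eqP. Qed.

Lemma tfiltE n x : tfilt n x <-> tsupp (fun i => (i <= n)%N) x.
Proof. by rewrite tsuppP. Qed.

Lemma tsupp_subspace P : subspace (tsupp P).
Proof.
split=> [m _|a x y Px Py m Pm]; first exact: mcoeff0.
by rewrite mcoeffD mcoeffZ Px // Py // mulr0 addr0.
Qed.

Lemma sub_tsupp (P Q : pred nat) x : subpred P Q -> tsupp P x -> tsupp Q x.
Proof. by move=> PQ Px m /(contra (PQ _)); apply: Px. Qed.

Lemma tsupp_word (P : pred nat) s : P (size s) -> tsupp P (word s).
Proof.
move=> Ps m Pm; rewrite coef_word (_ : (_ == s) = false) //.
by apply: contraNF Pm; rewrite fdegE => /eqP ->.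
Qed.

Lemma tsuppM (P Q R : pred nat) x y :
  (forall i j, P i -> Q j -> R (i + j)%N) ->
  tsupp P x -> tsupp Q y -> tsupp R (x * y).
Proof.
move=> PQR /tsuppP Px /tsuppP Qy m Rm; rewrite mcoeffMr big1_seq // => m2 /=.
move=> /Qy Qm2; rewrite big1_seq // => m1 /= /Px Pm1.
case: eqP => [def_m|_]; last by rewrite mulr0n.
by rewrite -def_m fdegM PQR in Rm.
Qed.

Lemma tdeg_subspace n : subspace (@tdeg k U n).
Proof.
split=> [|a x y]; first by apply/tdegE; case: (tsupp_subspace (pred1 n)).
by rewrite !tdegE => degx degy; apply: (proj2 (tsupp_subspace _)).
Qed.

Lemma tfilt_subspace n : subspace (@tfilt k U n).
Proof.
split=> [|a x y]; first by apply/tfiltE; case: (tsupp_subspace (leq^~ n)).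
by rewrite !tfiltE => degx degy; apply: (proj2 (tsupp_subspace _)).
Qed.

Lemma tdegM m n (x y : T) : tdeg m x -> tdeg n y -> tdeg (m + n) (x * y).
Proof.
by rewrite !tdegE; apply: tsuppM => i j /eqP -> /eqP ->; rewrite /= eqxx.
Qed.

Lemma tdeg_filt m n (x : T) : (m <= n)%N -> tdeg m x -> tfilt n x.
Proof. by move=> mn; rewrite tdegE tfiltE; apply: sub_tsupp => i /eqP ->. Qed.

Lemma tdeg_word s : tdeg (size s) (word s).
Proof. by apply/tdegE/tsupp_word/eqxx. Qed.

Lemma tdeg1 : tdeg 0 (1 : T).
Proof. by rewrite -word0; apply: tdeg_word. Qed.

Lemma tdeg_gen u : tdeg 1 (tgen u : T).
Proof.
rewrite (ebasis_sum u) linear_sum; apply: (subspace_sum (tdeg_subspace 1)) => i _.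
rewrite linearZ; apply: (subspaceZ _ (tdeg_subspace 1)).
by rewrite /= -[tgen _]mulr1 -word0 -word_cons; apply: tdeg_word.
Qed.

Lemma tdeg2_gen u v : tdeg 2 (tgen u * tgen v : T).
Proof. exact: (tdegM (@tdeg_gen u) (@tdeg_gen v)). Qed.

Lemma tdeg_ind (P : nat -> T -> Prop) :
  (forall n, subspace (P n)) -> P 0%N 1 ->
  (forall n i x, tdeg n x -> P n x -> P n.+1 (tgen (e i) * x)) ->
  forall n x, tdeg n x -> P n x.
Proof.
move=> subP P1 PM n x degx; rewrite [x]tensorE big_seq_cond.
apply: (subspace_sum (subP n)) => m /andP[/degx <- _]; apply: (subspaceZ _ (subP _)).
case: m => s; rewrite fdegE /=; elim: s => [|i s IHs]; first by rewrite word0.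
by rewrite word_cons; apply: PM => //; apply: tdeg_word.
Qed.

Lemma word_ind (P : T -> Prop) :
  subspace P -> (forall s, P (word s)) -> forall x, P x.
Proof.
move=> subP Pw x; rewrite [x]tensorE.
by apply: (subspace_sum subP) => m _; apply: (subspaceZ _ subP).
Qed.

Lemma tensor_ind (P : T -> Prop) :
  subspace P -> P 1 -> (forall i x, P x -> P (tgen (e i) * x)) ->
  forall x, P x.
Proof.
move=> subP P1 PM; apply: (word_ind subP).
elim=> [|i s IHs]; first by rewrite word0.
by rewrite word_cons; apply: PM.
Qed.

Lemma tdeg1P (x : T) : tdeg 1 x -> exists u, x = tgen u.
Proof.
move=> degx.
(* The induction on degree needs the scalars in degree 0 to reach degree 1; above degree 1 nothing
   is claimed. *)
pose P n (x : T) := match n with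
  | 0 => exists c, x = c%:A | 1 => exists u, x = tgen u | _ => True end.
apply: (tdeg_ind (P := P)) degx => [[|[|n]]| |[|n] i y _ /=] //.
- split=> [|a _ _ [c ->] [d ->]]; first by exists 0; rewrite scale0r.
  by exists (a * c + d); rewrite scalerDl scalerA.
- split=> [|a _ _ [u ->] [v ->]]; first by exists 0; rewrite linear0.
  by exists (a *: u + v); rewrite linearP.
- by exists 1; rewrite scale1r.
- by move=> [c ->]; exists (c *: e i); rewrite linearZ mulr_algr.
Qed.

Lemma tdeg2_ind (P : T -> Prop) :
  subspace P -> (forall i j, P (tgen (e i) * tgen (e j))) ->
  forall x, tdeg 2 x -> P x.
Proof.
move=> subP PM x degx; rewrite [x]tensorE big_seq_cond.
apply: (subspace_sum subP) => m /andP[/degx + _]; rewrite fdegE.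
by case: (m : seq _) => [|i [|j []]] // _; apply: (subspaceZ _ subP); rewrite word2.
Qed.

Lemma tgen_inj : injective (@tgen k U).
Proof.
move=> u v eq_uv; rewrite (ebasis_sum u) (ebasis_sum v).
apply: eq_bigr => i _; congr (_ *: _).
have coefE w : (tgen w)@_(fmu i) = coord (vbasis fullv) i w.
  rewrite /tgen raddf_sum (bigD1 i isT) /= mcoeffUU big1 ?addr0 // => j ne.
  by rewrite mcoeffU fmP !fmU /= eqseq_cons (negPf ne).
by rewrite -!coefE eq_uv.
Qed.

Section LinearExtension.
Variables (B : algType k) (h : seq letter -> B).

Definition word_ext (x : T) : B := \sum_(m <- msupp x) x@_m *: h m.

Let word_extE x : word_ext x = mmap (in_alg B) (fun m : {fmonom _} => h m) x.
Proof. by apply: eq_bigr => m _; rewrite mulr_algl. Qed.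

Lemma word_ext_is_linear : linear word_ext.
Proof.
move=> a x y; rewrite !word_extE raddfD /=; congr (_ + _).
rewrite (mmapEw (msuppZ_le _ _)) mmapE scaler_sumr; apply: eq_bigr => m _ /=.
by rewrite mcoeffZ !mulr_algl scalerA.
Qed.

HB.instance Definition _ :=
  GRing.isLinear.Build k T B _ word_ext word_ext_is_linear.

Lemma word_ext_word s : word_ext (word s) = h s.
Proof. by rewrite word_extE mmapU /= scale1r mul1r. Qed.
End LinearExtension.

Definition hcomp n : T -> T :=
  word_ext (fun s => if size s == n then word s else 0).

HB.instance Definition _ n := GRing.Linear.on (hcomp n).

Lemma hcomp_word n s : hcomp n (word s) = if size s == n then word s else 0.
Proof. exact: word_ext_word. Qed.

Lemma tdeg_hcomp n x : tdeg n (hcomp n x).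
Proof.
rewrite [x]tensorE linear_sum; apply: (subspace_sum (tdeg_subspace n)) => m _.
rewrite linearZ; apply: (subspaceZ _ (tdeg_subspace n)).
rewrite /= hcomp_word; case: eqP => [<-|_]; first exact: tdeg_word.
by case: (tdeg_subspace n).
Qed.

Lemma hcomp_id m n (x : T) : tdeg m x -> hcomp n x = if m == n then x else 0.
Proof.
move=> degx; rewrite {1}[x]tensorE linear_sum /= big_seq_cond.
rewrite (eq_bigr (fun w => if m == n then x@_w *: word w else 0)).
  rewrite -big_seq_cond; case: eqP => _; first by rewrite -tensorE.
  by rewrite big1.
move=> w /andP[/degx degw _]; rewrite linearZ /= hcomp_word -fdegE degw.
by case: eqP; rewrite ?scaler0.
Qed.

Lemma hcomp_sum x : exists N, x = \sum_(i < N) hcomp i x.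
Proof.
pose N := (\max_(m <- msupp x) (fdeg m).+1)%N; exists N.
rewrite {1}[x]tensorE; transitivity
    (\sum_(i < N) \sum_(m <- msupp x) hcomp i (x@_m *: word m)); last first.
  by apply: eq_bigr => i _; rewrite -linear_sum -tensorE.
rewrite exchange_big /=; apply: eq_big_seq => m mx.
have ltm : (fdeg m < N)%N by rewrite /N (big_rem m) //= leq_max leqnn.
rewrite (bigD1 (Ordinal ltm)) //= linearZ /= hcomp_word -fdegE eqxx.
rewrite big1 ?addr0 // => i ne; rewrite linearZ /= hcomp_word -fdegE.
by move: ne; rewrite -val_eqE eq_sym /= => /negPf ->; rewrite scaler0.
Qed.

Section QuadraticIdeal.
Variable S : T -> Prop.
Hypothesis S2 : forall s, S s -> tdeg 2 s.

(** By linearity [a] and [b] may be taken to be words; then [a * s * b] is homogeneous and each of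
    its components is either itself or 0. This makes the quotient graded. *)
Lemma ideal_gen_hcomp n x : ideal_gen S x -> ideal_gen S (hcomp n x).
Proof.
have subI := ideal_gen_subspace S.
elim/ideal_gen_min => [|y z Iy Iz|a s b Ss].
- by rewrite linear0; case: subI.
- by rewrite linearD /=; apply: (ideal_genDr Iy Iz).
elim/word_ind: a => [|m].
  split=> [|c a a' Ia Ia']; first by rewrite !mul0r linear0; case: subI.
  rewrite !mulrDl -!scalerAl linearD linearZ /=; apply: ideal_genDr; last exact Ia'.
  exact: (subspaceZ _ subI Ia).
elim/word_ind: b => [|m'].
  split=> [|c b b' Ib Ib']; first by rewrite mulr0 linear0; case: subI.
  rewrite mulrDr -scalerAr linearD linearZ /=; apply: ideal_genDr; last exact Ib'.
  exact: (subspaceZ _ subI Ib).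
have degm : tdeg (size m + 2 + size m') (word m * s * word m').
  by apply: tdegM; [apply: tdegM; [apply: tdeg_word|apply: S2] | apply: tdeg_word].
rewrite (hcomp_id n degm); case: eqP => _; last by case: subI.
exact: ideal_gen_in.
Qed.

Hypothesis subS : subspace S.

(** Controls the ideal in low degrees: it has nothing in degrees 0 and 1, and its part of degree 2
    is [S] itself. *)
Lemma ideal_gen_low x : ideal_gen S x ->
  exists2 s, S s & tsupp (fun n => 3 <= n)%N (x - s).
Proof.
have low1 (a : T) : tsupp (fun n => 1 <= n)%N (a - (a@_mone)%:A).
  move=> m; rewrite -eqn0Ngt fdeg_eq0 => /eqP ->.
  by rewrite mcoeffB mcoeffZ mcoeff1 eqxx mulr1 subrr.
have subL n := tsupp_subspace (fun m => n <= m)%N.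
elim/ideal_gen_min => [|y z [s Ss ys] [t St zt]|a s b Ss].
- by exists 0; rewrite ?subr0; [case: subS | case: (subL 3)].
- exists (s + t); first exact: (subspaceD subS Ss St).
  by rewrite opprD addrACA; apply: (subspaceD (subL 3) ys zt).
(* Only the constant terms of [a] and [b] contribute to [a * s * b] in degree 2. *)
exists ((a@_mone * b@_mone) *: s); first exact: (subspaceZ _ subS Ss).
set a0 := a@_mone; set b0 := b@_mone.
have ltot p (x0 : T) : tdeg p x0 -> tsupp (fun n => p <= n)%N x0.
  by move/tdegE; apply: sub_tsupp => i /eqP ->.
have -> : a * s * b - (a0 * b0) *: s =
    (a - a0%:A) * (s * b) + a0 *: (s * (b - b0%:A)).
  rewrite mulrBl mulr_algl mulrBr mulr_algr scalerBr scalerA mulrA.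
  by rewrite addrA subrK.
apply: (subspaceD (subL 3)).
  apply: (tsuppM _ (low1 a)) (_ : tsupp (fun n => 2 <= n)%N _) => [i j|].
    by move=> i1 j2; rewrite (leq_add i1 j2).
  apply: (tsuppM _ (ltot _ _ (S2 Ss))) (_ : tsupp predT _) => [i j i2 _|].
    by rewrite (leq_trans i2) ?leq_addr.
  by [].
apply: (subspaceZ _ (subL 3)); apply: tsuppM (ltot _ _ (S2 Ss)) (low1 b) => i j i2 j1.
exact: leq_add i2 j1.
Qed.

Lemma ideal_gen_deg2 x : tdeg 2 x -> ideal_gen S x -> S x.
Proof.
move=> degx /ideal_gen_low [s Ss low]; suff -> : x = s by [].
apply/subr0_eq/malgP => m; rewrite mcoeff0.
have [ltm|le3] := ltnP (fdeg m) 3; first by apply: low; rewrite -ltnNge.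
have /tdegE : tdeg 2 (x - s).
  exact: (subspaceB (tdeg_subspace 2) degx (S2 Ss)).
by apply; rewrite /= gtn_eqF.
Qed.

Lemma ideal_gen_filt1 x : tfilt 1 x -> ideal_gen S x -> x = 0.
Proof.
move=> /tfiltE filtx /ideal_gen_low [s Ss low]; apply/malgP => m.
rewrite mcoeff0; have [ltm|le2] := leqP (fdeg m) 1; last first.
  by apply: filtx; rewrite -ltnNge.
have := low m; rewrite mcoeffB -ltnNge => /(_ (leqW ltm)).
have /tdegE -> := S2 Ss; last by rewrite /= ltn_eqF.
by rewrite subr0.
Qed.

Lemma ideal_gen1 : ~ ideal_gen S 1.
Proof.
move/ideal_gen_filt1 => /(_ (tdeg_filt (leq0n _) tdeg1)) /eqP.
by rewrite oner_eq0.
Qed.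
End QuadraticIdeal.

Definition tsign : T -> T := tensor_lift (\- (@tgen k U) : {linear U -> T}).
HB.instance Definition _ := GRing.LRMorphism.on tsign.

Lemma tsign_gen u : tsign (tgen u) = - tgen u.
Proof. exact: tensor_lift_gen. Qed.

Lemma tsign_deg n (x : T) : tdeg n x -> tsign x = (-1) ^+ n *: x.
Proof.
apply: (tdeg_ind (P := fun n x => tsign x = (-1) ^+ n *: x)) => [{}n||{}n i {}x _ IH].
- split=> [|a x' y xE yE]; first by rewrite linear0 scaler0.
  by rewrite linearP /= xE yE scalerDr !scalerA mulrC.
- by rewrite rmorph1 scale1r.
by rewrite rmorphM /= tsign_gen IH -scalerAr mulNr exprS mulN1r scaleNr scalerN.
Qed.

(* The sign automorphism lets the graded Leibniz rule be stated for all elements. *)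
Lemma tensor_derivation (B : algType k) (pi : {lrmorphism T -> B})
    (delta : {linear U -> B}) :
  exists D : {linear T -> B}, (forall u, D (tgen u) = delta u) /\
    forall x y, D (x * y) = D x * pi y + pi (tsign x) * D y.
Proof.
pose Dw := fix Dw s := if s is i :: s' then
  delta (e i) * pi (word s') - pi (tgen (e i)) * Dw s' else 0.
pose D : {linear T -> B} := word_ext Dw; exists D.
have Dgen i : forall x, D (tgen (e i) * x) = delta (e i) * pi x - pi (tgen (e i)) * D x.
  apply: word_ind => [|s]; first exact: leibniz_gen_subspace.
  by rewrite /D /= -word_cons !word_ext_word.
have D1 : D 1 = 0 by rewrite -word0 /D /= word_ext_word.
split=> [u|].
  apply: (ebasis_ext (f := D \o @tgen k U)) u => i /=.
  by rewrite -[tgen _]mulr1 Dgen D1 rmorph1 mulr0 subr0 mulr1.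
apply: tensor_ind => [|y|i x IH].
- exact: leibniz_subspace.
- by rewrite mul1r D1 mul0r add0r !rmorph1 mul1r.
by apply: leibniz_gen_mul IH => //; apply: tsign_gen.
Qed.
End TensorAlgebra.

(** * Duality in degree 2 *)

Section Combinations.
Variables (k : fieldType) (M : lmodType k) (J : finType) (e : J -> M).

Lemma comb_subspace : subspace (fun x => exists s : J -> k, x = \sum_j s j *: e j).
Proof.
split=> [|a _ _ [s ->] [t ->]].
  by exists (fun=> 0); rewrite big1 // => j _; rewrite scale0r.
exists (fun j => a * s j + t j); rewrite scaler_sumr -big_split.
by apply: eq_bigr => j _ /=; rewrite scalerDl scalerA.
Qed.
End Combinations.

Lemma mul_comb (k : fieldType) (A : algType k) (I J : finType)
    (e : I -> A) (f : J -> A) (s : I -> k) (t : J -> k) :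
  (\sum_i s i *: e i) * (\sum_j t j *: f j) =
  \sum_p (s p.1 * t p.2) *: (e p.1 * f p.2).
Proof.
rewrite mulr_suml -(pair_bigA _ (fun i j => (s i * t j) *: (e i * f j))) /=.
apply: eq_bigr => i _; rewrite mulr_sumr; apply: eq_bigr => j _.
by rewrite -scalerAl -scalerAr scalerA.
Qed.

Section Pairing.
Variables (k : fieldType) (U : vectType k).
Local Notation T := (tensor U).
Local Notation Td := (tensor (dual U)).
Local Notation letter := 'I_(\dim (fullv : {vspace U})).
Local Notation e := (@ebasis k U).

(** The two partial applications of the pairing are named so that each can carry a linear
    structure. *)
Definition pairl (p : T) (x : Td) : k^o := @pairing k U x p.
Definition pairr (x : Td) (p : T) : k^o := @pairing k U x p.

Lemma pairl_is_linear p : linear (pairl p).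
Proof.
move=> a x y; rewrite /pairl /pairing scaler_sumr -big_split.
apply: eq_bigr => l _ /=; rewrite scaler_sumr -big_split.
apply: eq_bigr => m _ /=; rewrite scaler_sumr -big_split.
apply: eq_bigr => i _ /=; rewrite scaler_sumr -big_split.
apply: eq_bigr => j _ /=; rewrite mcoeffD mcoeffZ !mulrDl.
rewrite [in RHS]/GRing.scale /= !mulrA; reflexivity.
Qed.

Lemma pairr_is_linear x : linear (pairr x).
Proof.
move=> a p q; rewrite /pairr /pairing scaler_sumr -big_split.
apply: eq_bigr => l _ /=; rewrite scaler_sumr -big_split.
apply: eq_bigr => m _ /=; rewrite scaler_sumr -big_split.
apply: eq_bigr => i _ /=; rewrite scaler_sumr -big_split.
apply: eq_bigr => j _ /=; rewrite mcoeffD mcoeffZ mulrDr mulrDl [_ * (a * _)]mulrCA.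
rewrite [in RHS]/GRing.scale /= !mulrA; reflexivity.
Qed.

HB.instance Definition _ p :=
  GRing.isLinear.Build k Td k^o _ (pairl p) (pairl_is_linear p).
HB.instance Definition _ x :=
  GRing.isLinear.Build k T k^o _ (pairr x) (pairr_is_linear x).

Definition dcoord (i : letter) : 'Hom(U, k^o) :=
  linfun (coord (vbasis fullv) i : U -> k^o).

Lemma dcoordE i u : dcoord i u = coord (vbasis fullv) i u.
Proof. by rewrite lfunE. Qed.

Lemma dcoord_ebasis i j : dcoord i (e j) = (i == j)%:R.
Proof. by rewrite dcoordE coord_ebasis. Qed.

Lemma dual_sum (xi : 'Hom(U, k^o)) : xi = \sum_i xi (e i) *: dcoord i.
Proof.
apply/lfunP => u; rewrite {1}(ebasis_sum u) linear_sum sum_lfunE.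
apply: eq_bigr => i _; rewrite linearZ scale_lfunE dcoordE /=.
by rewrite /GRing.scale /= mulrC.
Qed.

(** The letters of [tensor (dual U)] come from the basis chosen for [dual U], which need not be dual
    to the one chosen for [U]. In the dual basis used here the pairing becomes the standard dot
    product of coefficients. *)
Definition dgen (i : letter) : Td := tgen (dcoord i : dual U).

Definition gen2 (t : letter * letter) : T := tgen (e t.1) * tgen (e t.2).
Definition dgen2 (t : letter * letter) : Td := dgen t.1 * dgen t.2.

Lemma pairing_dgen2 s t : pairing (dgen2 s) (gen2 t) = (s == t)%:R.
Proof.
rewrite pairingE !dcoord_ebasis; case: s t => [i j] [i' j'].
by rewrite xpair_eqE /=; case: (i == i'); case: (j == j'); rewrite ?(mul0r, mul1r).
Qed.

Lemma pairing_comb (s t : letter * letter -> k) :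
  pairing (\sum_j s j *: dgen2 j) (\sum_j t j *: gen2 j) = \sum_j s j * t j.
Proof.
rewrite -[LHS]/(pairl (\sum_j t j *: gen2 j) _) linear_sum.
apply: eq_bigr => i _; rewrite linearZ; congr (_ * _).
rewrite -[LHS]/(pairr (dgen2 i) _) linear_sum (bigD1 i isT) /= big1 => [|j ne].
  by rewrite addr0 linearZ /= /pairr pairing_dgen2 eqxx [_ *: _]mulr1.
by rewrite linearZ /= /pairr pairing_dgen2 eq_sym (negPf ne) [_ *: _]mulr0.
Qed.

Lemma tdeg2_comb (p : T) : tdeg 2 p ->
  exists s : letter * letter -> k, p = \sum_j s j *: gen2 j.
Proof.
apply: (tdeg2_ind (comb_subspace gen2)) => i j.
exists (fun t => (t == (i, j))%:R); rewrite (bigD1 (i, j) isT) /= eqxx scale1r.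
by rewrite big1 ?addr0 // => t /negPf ->; rewrite scale0r.
Qed.

Lemma tdeg2_dcomb (x : Td) : tdeg 2 x ->
  exists s : letter * letter -> k, x = \sum_j s j *: dgen2 j.
Proof.
apply: (tdeg2_ind (comb_subspace dgen2)) => i j.
have gE (a : dual U) : tgen a = \sum_i (a : 'Hom(U, k^o)) (e i) *: dgen i.
  rewrite {1}(dual_sum a) linear_sum; apply: eq_bigr => l _.
  by rewrite linearZ.
pose c (a : dual U) l : k := (a : 'Hom(U, k^o)) (e l).
exists (fun t => c (ebasis i) t.1 * c (ebasis j) t.2).
rewrite -[RHS](mul_comb dgen dgen (c (ebasis i)) (c (ebasis j))).
by congr (_ * _); apply: gE.
Qed.

Variable I : T -> Prop.
Hypotheses (subI : subspace I) (I2 : forall p, I p -> tdeg 2 p).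

Lemma annihilator_subspace : subspace (annihilator I).
Proof.
split=> [|a x y [degx annx] [degy anny]].
  split=> [|p _]; first by case: (@tdeg_subspace k (dual U) 2).
  exact: (linear0 (pairl p)).
split=> [|p Ip]; first exact: (proj2 (@tdeg_subspace k (dual U) 2)).
rewrite -[LHS]/(pairl p _) linearP /= [pairl p x](annx p Ip).
by rewrite [pairl p y](anny p Ip) scaler0 addr0.
Qed.

(** In the dual bases [gen2] and [dgen2] the pairing is a dot product, so this is I = I^perp^perp
    for a subspace of a finite-dimensional space. *)
Lemma annihilatorK p : tdeg 2 p ->
  (forall x, annihilator I x -> pairing x p = 0) -> I p.
Proof.
move=> /tdeg2_comb[s ->] annp; apply: double_annihilator => // y annI.
under eq_bigr => j _ do rewrite mulrC.
rewrite -pairing_comb; apply: annp; split=> [|q Iq].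
  apply: (subspace_sum (@tdeg_subspace k (dual U) 2)) => j _.
  by apply: (subspaceZ _ (@tdeg_subspace k (dual U) 2)); apply: tdeg2_gen.
have [t def_q] := tdeg2_comb (I2 Iq); rewrite def_q pairing_comb.
under eq_bigr => j _ do rewrite mulrC.
by apply: annI; rewrite -def_q.
Qed.

(** Surjectivity of T^2(U^* ) -> I^*: a functional on I extends to all tensors of degree 2, and the
    extension is a tensor of degree 2 on the dual. *)
Lemma pairing_represents (g : T -> k) : linear_on I (g : T -> k^o) ->
  exists2 x, tdeg 2 x & forall p, I p -> pairing x p = g p.
Proof.
move=> /(functional_extension gen2 subI)[y gE].
exists (\sum_j y j *: dgen2 j).
  apply: (subspace_sum (@tdeg_subspace k (dual U) 2)) => j _.
  by apply: (subspaceZ _ (@tdeg_subspace k (dual U) 2)); apply: tdeg2_gen.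
move=> p Ip; have [t def_p] := tdeg2_comb (I2 Ip).
rewrite def_p pairing_comb gE -?def_p //; apply: eq_bigr => j _; exact: mulrC.
Qed.
End Pairing.

Section TensorMap.
Variables (k : fieldType) (U U' : vectType k) (f : 'Hom(U, U')).

(* Sealed by Qed, as conversion would otherwise unfold sums in {malg _}. *)
Lemma tmap_sig :
  {g : {lrmorphism tensor U -> tensor U'} | forall u, g (tgen u) = tgen (f u)}.
Proof.
exists (tensor_lift (@tgen k U' \o f : {linear U -> tensor U'})).
exact: tensor_lift_gen.
Qed.

Definition tmap : {lrmorphism tensor U -> tensor U'} := sval tmap_sig.

Lemma tmap_gen u : tmap (tgen u) = tgen (f u).
Proof. exact: (svalP tmap_sig). Qed.

Lemma tmap_gen2 u v : tmap (tgen u * tgen v) = tgen (f u) * tgen (f v).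
Proof. by rewrite rmorphM; congr (_ * _); apply: tmap_gen. Qed.

Lemma tmap_deg n x : tdeg n x -> tdeg n (tmap x).
Proof.
apply: (tdeg_ind (P := fun n x => tdeg n (tmap x))) => [{}n||{}n i y _].
- split=> [|a y z degy degz].
    by rewrite linear0; case: (@tdeg_subspace k U' n).
  rewrite linearD linearZ /=.
  exact: (proj2 (@tdeg_subspace k U' n) a _ _ degy degz).
- by rewrite rmorph1; apply: tdeg1.
move=> degy; rewrite rmorphM /= tmap_gen.
exact: (tdegM (@tdeg_gen _ _ _) degy).
Qed.

Definition transpose (xi : dual U') : dual U :=
  ((xi : 'Hom(U', k^o)) \o f)%VF.

Lemma transpose_linear : linear transpose.
Proof. by move=> a x y; rewrite /transpose comp_lfunDl comp_lfunZl. Qed.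

HB.instance Definition _ :=
  GRing.isLinear.Build k (dual U') (dual U) _ transpose transpose_linear.

Definition dual_map : 'Hom(dual U', dual U) := linfun transpose.

Lemma dual_mapE (xi : 'Hom(U', k^o)) : dual_map xi = (xi \o f)%VF.
Proof. exact: lfunE. Qed.
End TensorMap.

Lemma pairing_adjoint (k : fieldType) (U U' : vectType k) (f : 'Hom(U, U')) x p :
  tdeg 2 x -> tdeg 2 p -> pairing (tmap (dual_map f) x) p = pairing x (tmap f p).
Proof.
move=> degx degp; move: x degx.
apply: (tdeg2_ind (equalizer_subspace (pairl p \o tmap (dual_map f))
                                      (pairl (tmap f p)))) => a b /=.
move: p degp; apply: (tdeg2_ind (equalizer_subspace
  (pairr (tmap (dual_map f) (tgen (ebasis a) * tgen (ebasis b))))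
  (pairr (tgen (ebasis a) * tgen (ebasis b)) \o tmap f))) => i j /=.
rewrite (tmap_gen2 (dual_map f)) (tmap_gen2 f) /pairr !dual_mapE !pairingE.
by congr (_ * _); apply: comp_lfunE.
Qed.

(** * Algebras presented by quadratic relations *)

Section Presented.
Variables (k : fieldType) (U : vectType k) (S : tensor U -> Prop).
Hypotheses (subS : subspace S) (S2 : forall s, S s -> tdeg 2 s).
Variables (B : algType k) (gr : nat -> B -> Prop) (grP : is_grading gr).
Variable pi : {lrmorphism tensor U -> B}.
Hypothesis pres : presents gr S pi.
Local Notation T := (tensor U).

Lemma presents_surj b : exists t, pi t = b.
Proof. by have [_ surj _] := pres; apply: surj. Qed.

Lemma presents_deg n (t : T) : tdeg n t -> gr n (pi t).
Proof.
have [gr1 _ _] := pres.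
apply: (tdeg_ind (P := fun n t => gr n (pi t))) => [m||m i x _ grx].
- split=> [|a x y grx gry]; first by rewrite linear0; case: (gr_sub grP m).
  by rewrite linearD linearZ /=; apply: (proj2 (gr_sub grP m)).
- by rewrite rmorph1; apply: gr_1.
by rewrite rmorphM; apply: (gr_M grP (gr1 _) grx).
Qed.

(** The grading of [B] is given abstractly, so a preimage [t] of [b] need not be homogeneous. The
    images of its components, with [b] subtracted in degree [n], sum to 0, and directness of the
    grading forces the component of degree [n] to map to [b]. *)
Lemma presents_homog n b : gr n b -> exists2 t, tdeg n t & pi t = b.
Proof.
move=> grb; have [t def_b] := presents_surj b; have [N sum_t] := hcomp_sum t.
(* The range must contain degree [n] even when all components of [t] stop below it; in that case [b]
   is 0. *)
pose M := maxn N n.+1.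
pose c i := (if (i < N)%N then pi (hcomp i t) else 0) - (if i == n then b else 0).
have gr_c i : gr i (c i).
  apply: subspaceB; first exact: (gr_sub grP).
    case: ifP => _; first exact: (presents_deg (@tdeg_hcomp _ _ i t)).
    by case: (gr_sub grP i).
  by case: eqP => [->|_] //; case: (gr_sub grP i).
have sum0 : \sum_(i < M) c i = 0.
  rewrite sumrB -big_mkcond /= -[X in _ - X]big_mkcond /=.
  have -> : \sum_(i < M | (i < N)%N) pi (hcomp i t) = b.
    rewrite -(big_ord_widen _ (fun i => pi (hcomp i t))) ?leq_maxl //.
    by rewrite -linear_sum -sum_t.
  have ltnM : (n < M)%N by rewrite leq_maxr.
  by rewrite (big_pred1 (Ordinal ltnM)) ?subrr // => i; rewrite -val_eqE.
have := gr_free grP gr_c sum0 (leq_maxr N n.+1); rewrite /c eqxx.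
case: ifP => _ /subr0_eq <-.
  by exists (hcomp n t) => //; apply: tdeg_hcomp.
by exists 0; rewrite ?linear0 //; case: (@tdeg_subspace k U n).
Qed.

Lemma presents_ker2 (t : T) : tdeg 2 t -> pi t = 0 <-> S t.
Proof.
have [_ _ ker] := pres; move=> degt; split=> [/ker|St].
  exact: (ideal_gen_deg2 S2 subS degt).
by apply/ker/ideal_gen_mem.
Qed.

Lemma presents_eq2 (s t : T) : tdeg 2 s -> tdeg 2 t -> pi s = pi t <-> S (s - t).
Proof.
move=> degs degt.
rewrite -(presents_ker2 (subspaceB (@tdeg_subspace k U 2) degs degt)) linearB /=.
by split=> [->|/subr0_eq]; rewrite ?subrr.
Qed.

(** Relations start in degree 2, so nothing is identified in degree 1. *)
Lemma presents_gen_inj u v : pi (tgen u) = pi (tgen v) -> u = v.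
Proof.
have [_ _ ker] := pres; move=> eq_uv; apply/subr0_eq/(@tgen_inj k U).
rewrite linear0; apply: (ideal_gen_filt1 S2 subS).
  exact: (tdeg_filt (leqnn 1) (@tdeg_gen k U _)).
apply/ker; rewrite (linearB (@tgen k U)) (linearB pi) /= eq_uv; apply: subrr.
Qed.

Lemma presents_gr1 b : gr 1 b -> exists u, pi (tgen u) = b.
Proof. by move=> /presents_homog[t /tdeg1P[u ->] <-]; exists u. Qed.

Lemma presents_gen_gr1 u : gr 1 (pi (tgen u)).
Proof. by have [gr1 _ _] := pres. Qed.

Lemma presents_ind (P : nat -> B -> Prop) :
  (forall n, subspace (P n)) -> P 0%N 1 ->
  (forall n u x, gr n x -> P n x -> P n.+1 (pi (tgen u) * x)) ->
  forall n x, gr n x -> P n x.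
Proof.
move=> subP P1 PM n _ /presents_homog[t degt <-].
apply: (tdeg_ind (P := fun n t => P n (pi t))) degt => [m||m i x degx Px].
- split=> [|a x y Px Py]; first by rewrite linear0; case: (subP m).
  by rewrite linearD linearZ /=; apply: (proj2 (subP m)).
- by rewrite rmorph1.
rewrite rmorphM /=; apply: PM => //; exact: presents_deg.
Qed.

Lemma presents_ext (C : algType k) (f g : {lrmorphism B -> C}) :
  (forall u, f (pi (tgen u)) = g (pi (tgen u))) -> f =1 g.
Proof.
move=> eq_fg x; have [t <-] := presents_surj x.
elim/tensor_ind: t => [|| i t IHt].
- exact: (equalizer_subspace (f \o pi) (g \o pi)).
- by rewrite !rmorph1.
by rewrite !rmorphM /= eq_fg IHt.
Qed.
End Presented.

(** * Affine substitutions in the tensor algebra *)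

Lemma scaler_add3 (k : fieldType) (M : lmodType k) (a : k) (x y z x' y' z' : M) :
  a *: (x + y + z) + (x' + y' + z') =
  (a *: x + x') + (a *: y + y') + (a *: z + z').
Proof. by rewrite !scalerDr (addrACA _ _ (x' + y')) (addrACA _ _ x'). Qed.

Lemma mul_affine (k : fieldType) (A : algType k) (x y : A) (a c : k) :
  (x + a%:A) * (y + c%:A) = x * y + (a *: y + c *: x) + (a * c)%:A.
Proof.
by rewrite mulrDl !mulrDr !mulr_algl mulr_algr scalerA !addrA [in RHS]addrAC.
Qed.

Section LowDegree.
Variables (k : fieldType) (U : vectType k).
Local Notation T := (tensor U).
Local Notation deg2_subspace := (@tdeg_subspace k U 2).

Lemma tgen_comb2 a c (u v : U) :
  a *: tgen u + c *: tgen v = tgen (a *: u + c *: v).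
Proof. by rewrite linearD !linearZ. Qed.

Definition low2 (p : T) (v : U) (c : k) : T := p + tgen v + c%:A.

Lemma low2P a p v c p' v' c' :
  a *: low2 p v c + low2 p' v' c' = low2 (a *: p + p') (a *: v + v') (a * c + c').
Proof.
apply: (etrans (scaler_add3 _ _ _ _ _ _ _)).
congr (_ + _ + _); first by rewrite (linearP (@tgen k U)).
by rewrite scalerDl scalerA.
Qed.

Lemma tfilt_low2 p v c : tdeg 2 p -> tfilt 2 (low2 p v c).
Proof.
move=> degp; apply: (subspaceD (@tfilt_subspace k U 2)).
  apply: (subspaceD (@tfilt_subspace k U 2)).
    exact: (tdeg_filt (leqnn 2) degp).
  exact: (tdeg_filt (leqnSn 1) (@tdeg_gen k U v)).
apply: (subspaceZ _ (@tfilt_subspace k U 2)).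
exact: (tdeg_filt (leq0n 2) (@tdeg1 k U)).
Qed.

Lemma tfilt2_low2 q : tfilt 2 q -> exists p v c, tdeg 2 p /\ q = low2 p v c.
Proof.
move=> filtq; rewrite [q]tensorE big_seq_cond.
have subP : subspace (fun q => exists p v c, tdeg 2 p /\ q = low2 p v c).
  split=> [|a _ _ [p [v [c [degp ->]]]] [p' [v' [c' [degp' ->]]]]].
    exists 0, 0, 0; split; first by case: deg2_subspace.
    by rewrite /low2 linear0 scale0r !addr0.
  exists (a *: p + p'), (a *: v + v'), (a * c + c').
  by split; [apply: (proj2 deg2_subspace) | apply: low2P].
apply: (subspace_sum subP) => m /andP[/filtq + _]; rewrite fdegE.
case: (m : seq _) => [|i [|j []]] // _; apply: (subspaceZ _ subP).
- exists 0, 0, 1; split; first by case: deg2_subspace.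
  by rewrite /low2 linear0 scale1r !add0r word0.
- exists 0, (ebasis i), 0; split; first by case: deg2_subspace.
  by rewrite /low2 add0r scale0r addr0 word_cons word0; apply: mulr1.
exists (tgen (ebasis i) * tgen (ebasis j)), 0, 0; split; first exact: tdeg2_gen.
by rewrite /low2 linear0 scale0r !addr0; apply: word2.
Qed.

End LowDegree.

Section AffineMap.
Variables (k : fieldType) (U U' : vectType k).
Variables (f : 'Hom(U, U')) (b : 'Hom(U, k^o)).

Lemma affine_map_sig : {g : {lrmorphism tensor U -> tensor U'} |
  forall u, g (tgen u) = tgen (f u) + (b u)%:A}.
Proof.
pose h u : tensor U' := tgen (f u) + (b u)%:A.
have h_lin : linear h.
  move=> a x y; rewrite /h !linearP scalerDr addrACA; congr (_ + _).
  by rewrite scalerDl scalerA.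
pose hl := HB.pack_for {linear U -> tensor U'} h
  (GRing.isLinear.Build _ _ _ _ h h_lin).
by exists (tensor_lift hl); apply: tensor_lift_gen.
Qed.

Definition affine_map : {lrmorphism tensor U -> tensor U'} := sval affine_map_sig.

Lemma affine_map_gen u : affine_map (tgen u) = tgen (f u) + (b u)%:A.
Proof. exact: (svalP affine_map_sig). Qed.

(** A representative of minus the supercommutator of [-b] with the transpose of [xi]: both have
    degree 1, so it is an anticommutator. *)
Definition affine_anti (xi : 'Hom(U', k^o)) : tensor (dual U) :=
  tgen (b : dual U) * tgen (dual_map f xi) +
  tgen (dual_map f xi) * tgen (b : dual U).

Lemma affine_anti_deg xi : tdeg 2 (affine_anti xi).
Proof.
by apply: (subspaceD (@tdeg_subspace k (dual U) 2)); apply: tdeg2_gen.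
Qed.

(** The linear part of (f(u) + b(u))(f(v) + b(v)), see [affine_lin_gen]. Defining its coordinates by
    pairing with [affine_anti] makes it linear on all tensors and dual to the supercommutator by
    construction. *)
Definition affine_lin (p : tensor U) : U' :=
  \sum_i pairr (affine_anti (dcoord i)) p *: ebasis i.

Lemma affine_lin_is_linear : linear affine_lin.
Proof.
move=> a x y; rewrite /affine_lin scaler_sumr -big_split; apply: eq_bigr => i _.
by rewrite linearP /= scalerDl scalerA.
Qed.

HB.instance Definition _ :=
  GRing.isLinear.Build k (tensor U) U' _ affine_lin affine_lin_is_linear.

Lemma pairr_affine_anti xi u v : pairr (affine_anti xi) (tgen u * tgen v) =
  b u * xi (f v) + xi (f u) * b v.
Proof.
rewrite -[LHS]/(pairl _ (affine_anti xi)) linearD /= /pairl !dual_mapE.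
by congr (_ + _); rewrite pairingE comp_lfunE.
Qed.

Lemma affine_lin_gen u v : affine_lin (tgen u * tgen v) = b u *: f v + b v *: f u.
Proof.
rewrite [f v]ebasis_sum [f u]ebasis_sum !scaler_sumr -big_split /=.
apply: eq_bigr => i _; rewrite pairr_affine_anti !dcoordE scalerDl !scalerA.
by rewrite [_ * b v]mulrC.
Qed.

Lemma affine_linE (xi : 'Hom(U', k^o)) p : tdeg 2 p ->
  xi (affine_lin p) = pairing (affine_anti xi) p.
Proof.
move: p; apply: (tdeg2_ind (equalizer_subspace (xi \o affine_lin)
                                               (pairr (affine_anti xi)))) => i j /=.
rewrite affine_lin_gen pairr_affine_anti linearD !linearZ /=.
by rewrite /GRing.scale /= [b _ * xi (f (ebasis i))]mulrC.
Qed.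

Lemma affine_map_deg2 p : tdeg 2 p ->
  affine_map p = low2 (tmap f p) (affine_lin p)
                      (pairing (tgen (b : dual U) * tgen (b : dual U)) p).
Proof.
pose bb := tgen (b : dual U) * tgen (b : dual U).
pose h p := low2 (tmap f p) (affine_lin p) (pairr bb p).
suff: forall p, tdeg 2 p -> affine_map p = h p by apply.
have sub_h : subspace (fun p => affine_map p = h p).
  split=> [|a x y hx hy]; first by rewrite /h !linear0 /low2 scale0r linear0 !addr0.
  rewrite /h (linearP affine_map) (linearP (tmap f)) (linearP affine_lin).
  by rewrite (linearP (pairr bb)) /= hx hy; apply: low2P.
apply: (tdeg2_ind sub_h) => i j.
set u := ebasis i; set v := ebasis j.
have E1 : affine_map (tgen u * tgen v) =
    (tgen (f u) + (b u)%:A) * (tgen (f v) + (b v)%:A).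
  by rewrite rmorphM; congr (_ * _); apply: affine_map_gen.
have E2 : h (tgen u * tgen v) = tgen (f u) * tgen (f v) +
    tgen (b u *: f v + b v *: f u) + (b u * b v)%:A.
  exact (congr2 +%R (congr2 +%R (tmap_gen2 f u v)
      (congr1 (@tgen k U') (affine_lin_gen u v)))
    (congr1 (fun c => c%:A) (pairingE b b u v))).
apply: (etrans E1); apply: (etrans (mul_affine _ _ _ _)); apply: etrans (esym E2).
congr (_ + _ + _).
exact: tgen_comb2.
Qed.
End AffineMap.

(** * Quadratic-linear-scalar relations *)

Lemma tdeg_tfilt_eq0 (k : fieldType) (U : vectType k) m n (x : tensor U) :
  (m < n)%N -> tdeg n x -> tfilt m x -> x = 0.
Proof.
move=> mn /tdegE degx /tfiltE filtx; apply/malgP => w; rewrite mcoeff0.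
have [le|lt] := leqP (fdeg w) m; last by apply: filtx; rewrite -ltnNge.
by apply: degx; rewrite /= ltn_eqF // (leq_ltn_trans le mn).
Qed.

Lemma addr_regroup (M : zmodType) (x y z y' z' t : M) :
  x + y + z + (y' + z') + t = x + (y + y') + (z + z' + t).
Proof. by rewrite !addrA -[_ + z + y']addrA [z + y']addrC !addrA. Qed.

Lemma linear_add3 (k : fieldType) (M N : lmodType k) (f : {linear M -> N}) x y a z :
  f (x + y + a *: z) = f x + f y + a *: f z.
Proof. by rewrite !linearD linearZ. Qed.

Section Hyperplane.
Variables (k : fieldType) (A : wqls k) (V : hyperplane A).
Local Notation T := (tensor (hp_space V)).
Local Notation ev := (evalT (wq_inc A) (sval V)).
Local Notation J2 := (@relJ2 k A (wq_W A) (wq_inc A) (sval V)).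
Local Notation I := (@relI k A (wq_W A) (wq_inc A) (sval V)).
Local Notation hinc := (@hp_inc k A V).

Lemma hp_inc_linear : linear hinc.
Proof. by move=> a x y; rewrite /hp_inc !linearP. Qed.

HB.instance Definition _ :=
  GRing.isLinear.Build k (hp_space V) A _ hinc hp_inc_linear.

Lemma hp_inc_dec (w : wq_W A) : exists v c, wq_inc A w = hinc v + c%:A.
Proof.
have [full _] := svalP V.
have : w \in (sval V + <[wq_e A]>)%VS by rewrite full memvf.
move=> /memv_addP[v Vv [_ /vlineP[c ->] ->]].
exists (vsproj (sval V) v), c.
by rewrite /hp_inc vsprojK // linearD linearZ /= wq_eE.
Qed.

Lemma hp_inc_uniq v c v' c' :
  hinc v + c%:A = hinc v' + c'%:A :> A -> v = v' /\ c = c'.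
Proof.
move=> eq_vc; have [_ cap0] := svalP V.
have e_neq0 : wq_e A != 0.
  by apply/eqP => e0; have := oner_neq0 A; rewrite -wq_eE e0 linear0 eqxx.
have eqW : vsval v + c *: wq_e A = vsval v' + c' *: wq_e A.
  by apply: (@wq_inc_inj _ A); rewrite !linearD !linearZ /= wq_eE.
have eqVe : vsval v - vsval v' = (c' - c) *: wq_e A.
  by apply/eqP; rewrite scalerBl subr_eq addrAC eq_sym subr_eq eqW addrC.
have : vsval v - vsval v' \in (sval V :&: <[wq_e A]>)%VS.
  rewrite memv_cap rpredB ?subvsP //= eqVe.
  by apply/vlineP; exists (c' - c).
rewrite cap0 memv0 => /eqP v0; split; first exact/val_inj/subr0_eq.
move/eqP: eqVe; rewrite v0 eq_sym scaler_eq0 (negPf e_neq0) orbF => /eqP.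
by move/subr0_eq.
Qed.

Lemma evalT_gen v : ev (tgen v) = hinc v.
Proof. exact: tensor_lift_gen. Qed.

Lemma evalT_low2 p v c : ev (low2 p v c) = ev p + (hinc v + c%:A).
Proof.
rewrite /low2 !linearD linearZ /= -addrA; congr (_ + (_ + _)).
  exact: evalT_gen.
by congr (_ *: _); apply: rmorph1.
Qed.

Lemma evalT_surj a : exists t, ev t = a.
Proof.
elim: (wq_gen a) => {a} [_ [w <-]||a x y _ [s <-] _ [t <-]|x y _ [s <-] _ [t <-]].
- have [v [c ->]] := hp_inc_dec w; exists (low2 0 v c).
  by rewrite evalT_low2 linear0 add0r.
- by exists 1; rewrite rmorph1.
- by exists (a *: s + t); rewrite linearD linearZ.
by exists (s * t); rewrite rmorphM.
Qed.

Lemma relJ2_subspace : subspace J2.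
Proof.
split=> [|a x y [filtx Jx] [filty Jy]].
  by split; [case: (@tfilt_subspace k (hp_space V) 2) | apply: linear0].
split; first exact: (proj2 (@tfilt_subspace k (hp_space V) 2)).
exact: (proj2 (kernel_subspace ev)).
Qed.

(** [V] and the unit are independent in [A], so no nonzero element of degree at most 1 is a
    relation: the leading part of a relation determines the rest. This is why phi and c are
    functions on I. *)
Lemma relJ2_low2_uniq p v c v' c' :
  J2 (low2 p v c) -> J2 (low2 p v' c') -> v = v' /\ c = c'.
Proof.
move=> [_ J] [_ J']; apply: hp_inc_uniq; apply: (addrI (ev p)).
by rewrite -!evalT_low2 [LHS]J [RHS]J'.
Qed.

Lemma relI_low2 p : I p <-> tdeg 2 p /\ exists v c, J2 (low2 p v c).
Proof.
split=> [[degp [q [filtq Jq] filtqp]]|[degp [v [c J2p]]]].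
  split=> //; have [p0 [v [c [degp0 def_q]]]] := tfilt2_low2 filtq.
  suff p0E : p0 = p by exists v, c; rewrite -p0E -def_q.
  (* The difference of the two leading parts is homogeneous of degree 2 and lies in T_1, hence
     vanishes. *)
  apply/subr0_eq/(tdeg_tfilt_eq0 (ltnSn 1)).
    exact: (subspaceB (@tdeg_subspace k (hp_space V) 2)).
  have filt1 : tfilt 1 (q - p - (tgen v + c%:A)).
    apply: (subspaceB (@tfilt_subspace k (hp_space V) 1) filtqp).
    apply: (subspaceD (@tfilt_subspace k (hp_space V) 1)).
      exact: (tdeg_filt (leqnn 1) (@tdeg_gen k _ v)).
    apply: (subspaceZ _ (@tfilt_subspace k (hp_space V) 1)).
    exact: (tdeg_filt (leq0n 1) (@tdeg1 k _)).
  suff <- : q - p - (tgen v + c%:A) = p0 - p by [].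
  rewrite def_q /low2 -(addrA p0); set z : T := tgen v + c%:A.
  by rewrite addrAC addrK.
split=> //; exists (low2 p v c) => //.
rewrite /low2 -(addrA p) [p + _]addrC addrK.
apply: (subspaceD (@tfilt_subspace k (hp_space V) 1)).
  exact: (tdeg_filt (leqnn 1) (@tdeg_gen k _ v)).
apply: (subspaceZ _ (@tfilt_subspace k (hp_space V) 1)).
exact: (tdeg_filt (leq0n 1) (@tdeg1 k _)).
Qed.

Lemma relI_deg p : I p -> tdeg 2 p.
Proof. by case. Qed.

Lemma relI_subspace : subspace I.
Proof.
split=> [|a x y].
  apply/relI_low2; split; first by case: (@tdeg_subspace k (hp_space V) 2).
  exists 0, 0; rewrite /low2 linear0 scale0r !addr0; by case: relJ2_subspace.
move=> /relI_low2[degx [v [c Jx]]] /relI_low2[degy [v' [c' Jy]]].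
apply/relI_low2; split.
  exact: (proj2 (@tdeg_subspace k (hp_space V) 2)).
exists (a *: v + v'), (a * c + c'); rewrite -low2P.
exact: (proj2 relJ2_subspace).
Qed.

(** Lower terms are chosen for each [p] in I, with the dummy value 0 elsewhere. Linearity is forced
    by uniqueness, since a combination of relations is a relation with the combined leading part. *)
Lemma phi_h_exists : exists phi c, is_phi_h (V := V) phi c.
Proof.
have dec p : exists vc : hp_space V * k, I p -> J2 (low2 p vc.1 vc.2).
  have [/relI_low2[_ [v [c Jp]]]|nIp] := classic (I p); first by exists (v, c).
  by exists (0, 0).
pose vc p := sval (constructive_indefinite_description _ (dec p)).
have Jvc p : I p -> J2 (low2 p (vc p).1 (vc p).2).
  by rewrite /vc; case: constructive_indefinite_description.
have vcP a x y : I x -> I y -> vc (a *: x + y) =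
    (a *: (vc x).1 + (vc y).1, a * (vc x).2 + (vc y).2).
  move=> Ix Iy; have Iz := proj2 relI_subspace a x y Ix Iy.
  have Jz := proj2 relJ2_subspace a _ _ (Jvc x Ix) (Jvc y Iy).
  rewrite low2P in Jz; have [] := relJ2_low2_uniq (Jvc _ Iz) Jz.
  by case: (vc (a *: x + y)) => /= ? ? -> ->.
exists (fun p => (vc p).1), (fun p => (vc p).2); split.
- by move=> a x y Ix Iy; rewrite vcP.
- by move=> a x y Ix Iy; rewrite vcP.
move=> q; split=> [Jq|[p Ip ->]]; last exact: Jvc.
have [p [v [c [degp def_q]]]] := tfilt2_low2 (proj1 Jq).
have Ip : I p by apply/relI_low2; split=> //; exists v, c; rewrite -def_q.
have Jp : J2 (low2 p v c) by rewrite -def_q.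
exists p; first exact Ip.
by have [-> ->] := relJ2_low2_uniq (Jvc p Ip) Jp.
Qed.

Section PhiH.
Variables (phi : T -> hp_space V) (c : T -> k).
Hypothesis phi_hP : is_phi_h phi c.

Lemma phi_h_mem p : I p -> J2 (low2 p (phi p) (c p)).
Proof. by case: phi_hP => _ _ J2P Ip; apply/J2P; exists p. Qed.

Lemma phi_h_low2 p v d : tdeg 2 p -> J2 (low2 p v d) ->
  [/\ I p, phi p = v & c p = d].
Proof.
move=> degp Jp; have Ip : I p by apply/relI_low2; split=> //; exists v, d.
by have [-> ->] := relJ2_low2_uniq (phi_h_mem Ip) Jp.
Qed.
End PhiH.
End Hyperplane.

Section AffineRelations.
Variables (k : fieldType) (A A' : wqls k) (V : hyperplane A) (V' : hyperplane A').
Variables (phi : tensor (hp_space V) -> hp_space V) (c : tensor (hp_space V) -> k).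
Variables (phi' : tensor (hp_space V') -> hp_space V').
Variable c' : tensor (hp_space V') -> k.
Hypotheses (phi_hP : is_phi_h phi c) (phi_hP' : is_phi_h phi' c').
Variables (f : 'Hom(hp_space V, hp_space V')) (b : 'Hom(hp_space V, k^o)).
Local Notation I := (@relI k A (wq_W A) (wq_inc A) (sval V)).
Local Notation I' := (@relI k A' (wq_W A') (wq_inc A') (sval V')).
Local Notation J2 := (@relJ2 k A (wq_W A) (wq_inc A) (sval V)).
Local Notation J2' := (@relJ2 k A' (wq_W A') (wq_inc A') (sval V')).
Local Notation bb := (tgen (b : dual (hp_space V)) * tgen (b : dual (hp_space V))).

Lemma affine_map_low2 p v d : tdeg 2 p -> affine_map f b (low2 p v d) =
  low2 (tmap f p) (affine_lin f b p + f v) (pairing bb p + b v + d).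
Proof.
move=> degp; have -> : affine_map f b (low2 p v d) =
    low2 (tmap f p) (affine_lin f b p) (pairing bb p) +
    (tgen (f v) + (b v)%:A) + d%:A.
  apply: (etrans (linear_add3 (affine_map f b) p (tgen v) d 1)).
  exact (congr2 +%R (congr2 +%R (affine_map_deg2 f b degp) (affine_map_gen f b v))
    (congr1 ( *:%R d) (rmorph1 (affine_map f b)))).
apply: (etrans (addr_regroup _ _ _ _ _ _)).
rewrite /low2; congr (_ + _ + _); first by rewrite (linearD (@tgen k _)).
by rewrite -!scalerDl.
Qed.

(** The image of a relation is again sorted by degree as a [low2]; uniqueness of the lower terms
    turns membership in J_2' into one condition per degree. *)
Lemma affine_relJ2 :
  (forall q : tensor (hp_space V), J2 q -> J2' (affine_map f b q)) <->
  (forall p, I p ->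
     [/\ I' (tmap f p), phi' (tmap f p) = affine_lin f b p + f (phi p)
       & c' (tmap f p) = pairing bb p + b (phi p) + c p]).
Proof.
split=> [J2P p Ip|IP q].
  have degp := relI_deg Ip.
  have := J2P _ (phi_h_mem phi_hP Ip); rewrite affine_map_low2 //.
  by move=> /(phi_h_low2 phi_hP') [] //; apply: tmap_deg.
case: (phi_hP) => _ _ J2P /J2P[p Ip ->]; have degp := relI_deg Ip.
rewrite -/(low2 p (phi p) (c p)) affine_map_low2 //.
by have [Ip' <- <-] := IP p Ip; apply: (phi_h_mem phi_hP').
Qed.
End AffineRelations.

(** * Morphisms of dual CDG-algebras *)

Lemma tensor_ext (k : fieldType) (U : vectType k) (A : algType k)
    (f g : {lrmorphism tensor U -> A}) :
  (forall u, f (tgen u) = g (tgen u)) -> f =1 g.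
Proof.
move=> eq_fg; apply: tensor_ind => [|| i t IHt].
- exact: (equalizer_subspace f g).
- by rewrite !rmorph1.
by rewrite !rmorphM /= eq_fg IHt.
Qed.

Section Represents.
Variables (k : fieldType) (A : wqls k) (V : hyperplane A) (D : qls_dual V).
Local Notation U := (hp_space V).
Local Notation pi := (qd_pi D).
Local Notation I := (@relI k A (wq_W A) (wq_inc A) (sval V)).
Local Notation rep := (represents pi).

Definition ann_sub := annihilator_subspace I.
Definition ann_deg (x : tensor (dual U)) (annx : annihilator I x) := proj1 annx.

Definition qd_homog := presents_homog (cdg_grP D) (qd_pres D).
Definition qd_deg := presents_deg (cdg_grP D) (qd_pres D).
Definition qd_eq2 := presents_eq2 ann_sub ann_deg (qd_pres D).
Definition qd_ker2 := presents_ker2 ann_sub ann_deg (qd_pres D).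
Definition qd_gen_inj := presents_gen_inj ann_sub ann_deg (qd_pres D).
Definition qd_gr1 := presents_gr1 (cdg_grP D) (qd_pres D).
Definition qd_ind := presents_ind (cdg_grP D) (qd_pres D).
Definition qd_surj := presents_surj (qd_pres D).

Lemma represents_lin a b g b' g' : rep b g -> rep b' g' ->
  rep (a *: b + b') (fun p => a * g p + g' p).
Proof.
move=> [x [degx <- xE]] [x' [degx' <- xE']]; exists (a *: x + x'); split.
- exact: (proj2 (@tdeg_subspace k (dual U) 2)).
- exact: linearP.
move=> p Ip; rewrite -(xE p Ip) -(xE' p Ip).
exact: (linearP (pairl p)).
Qed.

(** The isomorphism B^2 = I^*: equations in degree 2 of the dual become equations between
    functionals on I. *)
Lemma represents_eq b g b' g' : rep b g -> rep b' g' ->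
  b = b' <-> forall p, I p -> g p = g' p.
Proof.
move=> [x [degx <- xE]] [x' [degx' <- xE']].
have pairB p : pairing (x - x') p = pairing x p - pairing x' p.
  exact: (linearB (pairl p)).
rewrite (qd_eq2 degx degx'); split=> [[_ annx] p Ip|eq_g].
  by apply: subr0_eq; rewrite -xE // -xE' // -pairB annx.
split=> [|p Ip]; first exact: (subspaceB (@tdeg_subspace k (dual U) 2)).
by rewrite pairB xE // xE' // eq_g // subrr.
Qed.

Lemma represents_pi x : tdeg 2 x -> rep (pi x) (pairing x).
Proof. by move=> degx; exists x. Qed.

End Represents.

Lemma scomm_subspace (k : fieldType) (B : algType k) m n (a : B) :
  linear (scomm m n a).
Proof.
move=> c x y; rewrite /scomm mulrDr mulrDl -scalerAr -scalerAl mulrDr -scalerAr.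
by rewrite scalerBr opprD addrACA.
Qed.

HB.instance Definition _ (k : fieldType) (B : algType k) m n (a : B) :=
  GRing.isLinear.Build k B B _ (scomm m n a) (scomm_subspace m n a).

(** The two terms [u * a * y] cancel. Bracketing with an element of degree 1 is thus an odd
    derivation, like [d], and compatibility with [d] can be checked on generators. *)
Lemma scomm_leibniz (k : fieldType) (B : algType k) n (a u y : B) :
  scomm 1 1 a u * y - u * scomm 1 n a y = scomm 1 n.+1 a (u * y).
Proof.
rewrite /scomm !mul1n expr1 exprS !mulN1r opprK mulNr opprK mulrDl mulrBr.
rewrite opprB addrA addrAC -!mulrA addrK; congr (_ + _).
by rewrite [LHS]mulrA (commr_sign u n) -!mulrA.
Qed.

Lemma addr_move (R : nzRingType) (x y z c : R) :
  c = -1 * x + (-1 * y + z) <-> z = x + y + c.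
Proof.
by rewrite !mulN1r addrA -opprD; split=> ->; rewrite ?addNKr ?addKr.
Qed.

Lemma cdg_d1 (k : fieldType) (B : cdg k) : cdg_d B 1 = 0.
Proof.
have := cdg_dM 1 (gr_1 (cdg_grP B)); rewrite !mul1r mulr1.
by move/esym/eqP; rewrite -[X in _ == X]addr0 => /eqP /addrI.
Qed.

Lemma scomm11N (k : fieldType) (B : algType k) (x y : B) :
  scomm 1 1 (- x) y = - (x * y + y * x).
Proof. by rewrite /scomm mulN1r opprK mulNr mulrN -opprD. Qed.

Section DualMorphism.
Variables (k : fieldType) (A A' : wqls k) (V : hyperplane A) (V' : hyperplane A').
Variables (D : qls_dual V) (D' : qls_dual V').
Local Notation U := (hp_space V).
Local Notation U' := (hp_space V').
Local Notation I := (@relI k A (wq_W A) (wq_inc A) (sval V)).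
Local Notation I' := (@relI k A' (wq_W A') (wq_inc A') (sval V')).
Local Notation pi := (qd_pi D).
Local Notation pi' := (qd_pi D').
Variables (f : 'Hom(U, U')) (b : 'Hom(U, k^o)).
Local Notation alpha := (- pi (tgen (b : dual U))).
Local Notation bb := (tgen (b : dual U) * tgen (b : dual U)).

Section Given.
Variable g : {lrmorphism D' -> D}.
Hypothesis g_gen : forall xi : 'Hom(U', k^o),
  g (pi' (tgen (xi : dual _))) = pi (tgen ((xi \o f)%VF : dual _)).

Lemma dual_mor_tmap x : g (pi' x) = pi (tmap (dual_map f) x).
Proof.
apply: (tensor_ext (f := g \o pi') (g := pi \o tmap (dual_map f))) x => xi /=.
by rewrite tmap_gen dual_mapE; apply: g_gen.
Qed.

Lemma dual_mor_gr n x : cdg_gr n x -> cdg_gr n (g x).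
Proof.
move=> /(qd_homog (D := D'))[t degt <-]; rewrite dual_mor_tmap.
exact/qd_deg/tmap_deg.
Qed.

(** I' is its own double annihilator. If [x] annihilates I', it vanishes in the source of [g], so
    its transpose [tmap (dual_map f) x] vanishes in the target and annihilates I; adjunction moves
    this back to [tmap f p]. *)
Lemma dual_mor_relI p : I p -> I' (tmap f p).
Proof.
move=> Ip; have degp := relI_deg Ip.
apply: (annihilatorK (relI_subspace V') (@relI_deg _ _ V')) => [|x annx].
  exact: tmap_deg.
have degx := proj1 annx.
rewrite -(pairing_adjoint f degx degp).
have /(qd_ker2 D (tmap_deg (f := dual_map f) degx))[_] : pi (tmap (dual_map f) x) = 0.
  by rewrite -dual_mor_tmap (proj2 (qd_ker2 D' degx)) // rmorph0.
exact.
Qed.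

Lemma dual_mor_represents b' g' : (forall p, I p -> I' (tmap f p)) ->
  represents pi' b' g' -> represents pi (g b') (fun p => g' (tmap f p)).
Proof.
move=> fI [x [degx <- xE]]; exists (tmap (dual_map f) x); split.
- exact: tmap_deg.
- by rewrite dual_mor_tmap.
by move=> p Ip; rewrite (pairing_adjoint f degx (relI_deg Ip)) xE //; apply: fI.
Qed.

Variables (phi : tensor U -> U) (c : tensor U -> k).
Variables (phi' : tensor U' -> U') (c' : tensor U' -> k).
Hypotheses
  (dE : forall xi : 'Hom(U, k^o),
    represents pi (cdg_d D (pi (tgen (xi : dual _)))) (fun p => xi (phi p)))
  (hE : represents pi (cdg_h D) c)
  (dE' : forall xi : 'Hom(U', k^o),
    represents pi' (cdg_d D' (pi' (tgen (xi : dual _)))) (fun p => xi (phi' p)))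
  (hE' : represents pi' (cdg_h D') c').
Hypothesis fI : forall p, I p -> I' (tmap f p).

(** Both sides of the first equation lie in B^2 = I^*. As functionals of p they are [xi (f (phi p))]
    and [xi (phi' (tmap f p)) - xi (affine_lin f b p)]; letting [xi] vary gives equality of
    vectors. *)
Lemma dual_mor_d_gen :
  (forall xi : 'Hom(U', k^o), cdg_d D (g (pi' (tgen (xi : dual _)))) =
     g (cdg_d D' (pi' (tgen (xi : dual _)))) +
     scomm 1 1 alpha (g (pi' (tgen (xi : dual _))))) <->
  (forall p, I p -> phi' (tmap f p) = affine_lin f b p + f (phi p)).
Proof.
have sE (xi : 'Hom(U', k^o)) : scomm 1 1 alpha (g (pi' (tgen (xi : dual _)))) =
    - pi (affine_anti f b xi).
  have antiE : pi (affine_anti f b xi) =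
      pi (tgen (b : dual U)) * pi (tgen ((xi \o f)%VF : dual U)) +
      pi (tgen ((xi \o f)%VF : dual U)) * pi (tgen (b : dual U)).
    rewrite /affine_anti dual_mapE.
    exact (etrans (linearD pi _ _) (congr2 +%R (rmorphM pi _ _) (rmorphM pi _ _))).
  by rewrite g_gen antiE; apply: scomm11N.
have repR (xi : 'Hom(U', k^o)) := represents_lin (-1)
  (represents_pi D (@affine_anti_deg k _ _ f b xi)) (dual_mor_represents fI (dE' xi)).
have repL (xi : 'Hom(U', k^o)) := dE (xi \o f)%VF.
have eqR (xi : 'Hom(U', k^o)) : g (cdg_d D' (pi' (tgen (xi : dual _)))) +
     scomm 1 1 alpha (g (pi' (tgen (xi : dual _)))) =
     -1 *: pi (affine_anti f b xi) + g (cdg_d D' (pi' (tgen (xi : dual _)))).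
  by rewrite sE scaleN1r addrC.
split=> [dg p Ip|phiE xi].
  apply: subr0_eq; rewrite opprD addrA [LHS]ebasis_sum big1 // => i _.
  have /(represents_eq (repL (dcoord i)) (repR (dcoord i))) /(_ p Ip) :
      cdg_d D (pi (tgen ((dcoord i \o f)%VF : dual _))) =
      -1 *: pi (affine_anti f b (dcoord i)) +
      g (cdg_d D' (pi' (tgen (dcoord i : dual _)))).
    by rewrite -g_gen -eqR; apply: dg.
  rewrite comp_lfunE -(affine_linE f b _ (relI_deg Ip)) !dcoordE => eqi.
  by rewrite !linearB /= eqi mulN1r [- _ + _]addrC subrr scale0r.
rewrite eqR g_gen; apply/(represents_eq (repL xi) (repR xi)) => p Ip.
rewrite comp_lfunE -(affine_linE f b _ (relI_deg Ip)) phiE // linearD.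
by rewrite mulN1r addKr.
Qed.

(** As functionals on I, the image of h', the differential of [alpha] and the square of [alpha] are
    [c' (tmap f p)], [- b (phi p)] and [pairing bb p]; the sign of [b] disappears in the square. *)
Lemma dual_mor_h :
  cdg_h D = g (cdg_h D') + cdg_d D alpha - alpha ^+ 2 <->
  (forall p, I p -> c' (tmap f p) = pairing bb p + b (phi p) + c p).
Proof.
have repR := represents_lin (-1) (represents_pi D (@tdeg2_gen k _ b b))
  (represents_lin (-1) (dE b) (dual_mor_represents fI hE')).
have -> : g (cdg_h D') + cdg_d D alpha - alpha ^+ 2 =
    -1 *: pi bb + (-1 *: cdg_d D (pi (tgen (b : dual U))) + g (cdg_h D')).
  by rewrite linearN sqrrN !scaleN1r rmorphM /= expr2 addrC [_ + g _]addrC.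
rewrite (represents_eq hE repR); split=> cE p Ip.
  exact: (proj1 (addr_move _ _ _ _) (cE p Ip)).
exact: (proj2 (addr_move _ _ _ _) (cE p Ip)).
Qed.

(** Both [cdg_d D \o g] and the right-hand side obey the same signed Leibniz rule along [g], so
    agreement on generators propagates to all degrees. *)
Lemma dual_mor_cdg_hom :
  (forall xi : 'Hom(U', k^o), cdg_d D (g (pi' (tgen (xi : dual _)))) =
     g (cdg_d D' (pi' (tgen (xi : dual _)))) +
     scomm 1 1 alpha (g (pi' (tgen (xi : dual _))))) ->
  cdg_h D = g (cdg_h D') + cdg_d D alpha - alpha ^+ 2 ->
  exists G : cdg_hom D' D, ch_f G = g /\ ch_a G = alpha.
Proof.
move=> dg hg; have alpha_gr : cdg_gr 1 alpha.
  apply: (subspaceN (gr_sub (cdg_grP D) 1)).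
  exact: (presents_gen_gr1 (qd_pres D)).
have g_d n x : cdg_gr n x ->
    cdg_d D (g x) = g (cdg_d D' x) + scomm 1 n alpha (g x).
  apply: (qd_ind (D := D') (P := fun n x => cdg_d D (g x) =
    g (cdg_d D' x) + scomm 1 n alpha (g x))) => [m||m xi y gry IHy].
  - exact: (equalizer_subspace (cdg_d D \o g)
      ((g \o cdg_d D') \+ (scomm 1 m alpha \o g))).
  - by rewrite rmorph1 !cdg_d1 linear0 add0r /scomm muln0 mulr1 !mul1r subrr.
  have grxi := presents_gen_gr1 (qd_pres D') xi.
  rewrite rmorphM /= (cdg_dM _ (dual_mor_gr grxi)) (cdg_dM _ grxi) dg IHy.
  rewrite !mulN1r rmorphB !rmorphM /=.
  move: (g (pi' (tgen xi))) (g (cdg_d D' (pi' (tgen xi)))) => u v.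
  move: (g y) (g (cdg_d D' y)) => w z.
  rewrite -scomm_leibniz mulrDl mulrDr opprD addrACA.
  by [].
by exists (MkCDGHom (@dual_mor_gr) alpha_gr g_d hg).
Qed.
End Given.

(** By adjunction the transpose of [f] maps the annihilator of I' into that of I, hence descends to
    the quotients. *)
Lemma dual_mor_alg : (forall p, I p -> I' (tmap f p)) ->
  exists g : {lrmorphism D' -> D}, forall xi : 'Hom(U', k^o),
    g (pi' (tgen (xi : dual _))) = pi (tgen ((xi \o f)%VF : dual _)).
Proof.
move=> fI; have [g gE] : exists g : {lrmorphism D' -> D},
    forall x, g (pi' x) = (pi \o tmap (dual_map f)) x.
  apply: (descend_lrmorphism (@qd_surj _ _ _ D')
    (g := pi \o tmap (dual_map f))) => x.
  have [_ _ ker] := qd_pres D'; move=> /ker; apply: ideal_gen_ker => s anns /=.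
  have degs := proj1 anns.
  apply/(qd_ker2 D (tmap_deg (f := dual_map f) degs)); split=> [|p Ip].
    exact: tmap_deg.
  rewrite (pairing_adjoint f degs (relI_deg Ip)).
  exact: (proj2 anns _ (fI p Ip)).
by exists g => xi; rewrite gE /= tmap_gen dual_mapE.
Qed.
End DualMorphism.

(** * The correspondence of morphisms *)

Lemma linfun_exists (k : fieldType) (U W : vectType k) (f : U -> W) :
  linear f -> exists g : 'Hom(U, W), g =1 f.
Proof.
move=> f_lin; pose fl := HB.pack_for {linear U -> W} f
  (GRing.isLinear.Build _ _ _ _ f f_lin).
by exists (linfun fl) => u; rewrite lfunE.
Qed.

Section Morphisms.
Variables (k : fieldType) (A A' : wqls k) (V : hyperplane A) (V' : hyperplane A').
Local Notation U := (hp_space V).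
Local Notation U' := (hp_space V').
Local Notation I := (@relI k A (wq_W A) (wq_inc A) (sval V)).
Local Notation I' := (@relI k A' (wq_W A') (wq_inc A') (sval V')).
Local Notation J2 := (@relJ2 k A (wq_W A) (wq_inc A) (sval V)).
Local Notation J2' := (@relJ2 k A' (wq_W A') (wq_inc A') (sval V')).
Local Notation ev := (evalT (wq_inc A) (sval V)).
Local Notation ev' := (evalT (wq_inc A') (sval V')).

Definition affine_on (F : {lrmorphism A -> A'}) (f : 'Hom(U, U'))
    (b : 'Hom(U, k^o)) : Prop :=
  forall v, F (hp_inc v) = hp_inc (f v) + b v *: 1.

(** The decomposition of W' as V' plus multiples of e is unique, so pointwise chosen components of
    [F] on [V] are automatically linear. *)
Lemma wqls_hom_affine (F : wqls_hom A A') : exists f b, affine_on (wh_f F) f b.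
Proof.
have dec v : exists vc : U' * k, wh_f F (hp_inc (V := V) v) = hp_inc vc.1 + vc.2 *: 1.
  have [w' ->] := wh_W F (vsval v); have [v' [c ->]] := hp_inc_dec V' w'.
  by exists (v', c).
pose vc v := sval (constructive_indefinite_description _ (dec v)).
have vcE v : wh_f F (hp_inc (V := V) v) = hp_inc (vc v).1 + (vc v).2 *: 1.
  by rewrite /vc; case: constructive_indefinite_description.
have vcP a x y : (vc (a *: x + y)).1 = a *: (vc x).1 + (vc y).1 /\
                 (vc (a *: x + y)).2 = a * (vc x).2 + (vc y).2.
  apply: hp_inc_uniq; rewrite -vcE.
  rewrite (linearP (@hp_inc k A V)) linearP /= !vcE.
  rewrite (linearP (@hp_inc k A' V')) /= scalerDr scalerDl -scalerA.
  by rewrite addrACA.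
have [f fE] := linfun_exists (fun a x y => proj1 (vcP a x y)).
have [b bE] := linfun_exists (W := k^o) (f := fun v => (vc v).2)
  (fun a x y => proj2 (vcP a x y)).
by exists f, b => v; rewrite fE bE vcE.
Qed.

Lemma affine_on_eval (F : {lrmorphism A -> A'}) f b :
  affine_on F f b -> forall t, ev' (affine_map f b t) = F (ev t).
Proof.
move=> Ff; apply: (tensor_ext (f := ev' \o affine_map f b) (g := F \o ev)) => v /=.
rewrite affine_map_gen linearD linearZ /= rmorph1 !evalT_gen.
by rewrite Ff.
Qed.

Lemma affine_on_relJ2 (F : {lrmorphism A -> A'}) f b :
  affine_on F f b -> forall q, J2 q -> J2' (affine_map f b q).
Proof.
move=> Ff q [filtq Jq]; split; last by rewrite /relJ (affine_on_eval Ff) Jq rmorph0.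
have [p [v [c [degp ->]]]] := tfilt2_low2 filtq.
by rewrite affine_map_low2 //; apply/tfilt_low2/tmap_deg.
Qed.

(** Here J being generated by J_2 enters: a substitution that respects relations of degree at most 2
    kills all of J in A' and descends to A. *)
Lemma affine_on_exists f b :
  (forall q, J2 q -> J2' (affine_map f b q)) ->
  exists F : wqls_hom A A', affine_on (wh_f F) f b.
Proof.
move=> J2P; have [F FE] : exists F : {lrmorphism A -> A'},
    forall t, F (ev t) = (ev' \o affine_map f b) t.
  apply: (descend_lrmorphism (@evalT_surj k A V) (g := ev' \o affine_map f b)).
  move=> t Jt; have := wq_rel (svalP V) Jt; apply: ideal_gen_ker => s /J2P.
  by case.
have Ff : affine_on F f b.
  move=> v; rewrite -evalT_gen FE /= affine_map_gen linearD linearZ /=.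
  by rewrite rmorph1 evalT_gen.
have FW w : exists w', F (wq_inc A w) = wq_inc A' w'.
  have [v [c ->]] := hp_inc_dec V w; rewrite linearD linearZ /= rmorph1 Ff.
  exists (vsval (f v) + (b v + c) *: wq_e A').
  by rewrite linearD linearZ /= wq_eE scalerDl addrA.
by exists (MkWQLSHom FW).
Qed.

Lemma affine_on_inj (F G : wqls_hom A A') f b :
  affine_on (wh_f F) f b -> affine_on (wh_f G) f b -> F = G.
Proof.
move=> Ff Gf; apply: wqls_hom_ext => a; have [t <-] := evalT_surj V a.
by rewrite -(affine_on_eval Ff) -(affine_on_eval Gf).
Qed.

Lemma affine_on_uniq (F : {lrmorphism A -> A'}) f b f' b' :
  affine_on F f b -> affine_on F f' b' -> f = f' /\ b = b'.
Proof.
move=> Ff Ff'; have eqv v : f v = f' v /\ b v = b' v.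
  by apply: hp_inc_uniq; rewrite -Ff -Ff'.
by split; apply/lfunP => v; case: (eqv v).
Qed.

Variables (D : qls_dual V) (D' : qls_dual V').

Lemma is_dual_mor_exists (F : wqls_hom A A') : exists g, is_dual_mor D D' F g.
Proof.
have [f [b Ff]] := wqls_hom_affine F.
have [phi [c [phi_hP dE hE]]] := qd_dh D.
have [phi' [c' [phi_hP' dE' hE']]] := qd_dh D'.
have IP := proj1 (affine_relJ2 phi_hP phi_hP' f b) (affine_on_relJ2 Ff).
have fI p : I p -> I' (tmap f p) by move=> /IP[].
have [g gE] := dual_mor_alg D D' fI.
have [G [Gg Ga]] : exists G : cdg_hom D' D, ch_f G = g /\
    ch_a G = - qd_pi D (tgen (b : dual U)).
  apply: (dual_mor_cdg_hom gE).
    by apply: (proj2 (dual_mor_d_gen b gE dE dE' fI)) => p /IP[].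
  by apply: (proj2 (dual_mor_h b gE dE hE hE' fI)) => p /IP[].
by exists G, f, b; split=> //; rewrite Gg.
Qed.

Lemma is_dual_mor_uniq F g g' :
  is_dual_mor D D' F g -> is_dual_mor D D' F g' -> g = g'.
Proof.
move=> [f [b [Ff gf gb]]] [f' [b' [Ff' gf' gb']]].
have [eqf eqb] := affine_on_uniq Ff Ff'; subst f' b'.
apply: cdg_hom_ext; last by rewrite gb gb'.
by apply: (presents_ext (qd_pres D')) => xi; rewrite gf gf'.
Qed.

(** B^1 is V^* without identifications, so [g] determines the transpose of f and b; a linear map is
    recovered from its transpose, and [V] with 1 generates [A]. *)
Lemma is_dual_mor_inj F F' g :
  is_dual_mor D D' F g -> is_dual_mor D D' F' g -> F = F'.
Proof.
move=> [f [b [Ff gf gb]]] [f' [b' [Ff' gf' gb']]].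
suff [eqf eqb] : f = f' /\ b = b'.
  by subst f' b'; apply: affine_on_inj Ff Ff'.
split; last first.
  by apply: (@qd_gen_inj _ _ _ D); apply: oppr_inj; exact (etrans (esym gb) gb').
have eq_comp (xi : 'Hom(U', k^o)) : (xi \o f = xi \o f')%VF.
  by apply: (@qd_gen_inj _ _ _ D); exact (etrans (esym (gf xi)) (gf' xi)).
apply/lfunP => v; rewrite [f v]ebasis_sum [f' v]ebasis_sum.
apply: eq_bigr => i _; rewrite -!dcoordE.
by have /lfunP/(_ v) := eq_comp (dcoord i); rewrite !comp_lfunE => ->.
Qed.

(* f is reconstructed from its transpose, the action of g on degree 1. *)
Lemma is_dual_mor_surj (g : cdg_hom D' D) : exists F, is_dual_mor D D' F g.
Proof.
have dec (xi : dual U') : exists eta : dual U,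
    qd_pi D (tgen eta) = ch_f g (qd_pi D' (tgen xi)).
  apply: qd_gr1; apply: ch_f_gr; exact: (presents_gen_gr1 (qd_pres D')).
pose eta xi := sval (constructive_indefinite_description _ (dec xi)).
have etaE xi : qd_pi D (tgen (eta xi)) = ch_f g (qd_pi D' (tgen xi)).
  by rewrite /eta; case: constructive_indefinite_description.
have eta_lin : linear eta.
  move=> a x y; apply: (@qd_gen_inj _ _ _ D); apply: (etrans (etaE _)).
  pose L : {linear dual U -> D} := qd_pi D \o @tgen k (dual U).
  pose R : {linear dual U' -> D} := ch_f g \o qd_pi D' \o @tgen k (dual U').
  apply: (etrans (linearP R a x y)); apply: etrans (esym (linearP L a _ _)).
  exact (congr2 (fun s t => a *: s + t) (esym (etaE x)) (esym (etaE y))).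
have [etah etahE] := linfun_exists eta_lin.
(* The i-th coordinate of [f v] has to be the transposed i-th coordinate functional evaluated at
   [v]. *)
pose fv v : U' := \sum_i (etah (dcoord i : dual U') : 'Hom(U, k^o)) v *: ebasis i.
have fv_lin : linear fv.
  move=> a x y; rewrite /fv scaler_sumr -big_split; apply: eq_bigr => i _.
  by rewrite linearP /= scalerDl scalerA.
have [f fE] := linfun_exists fv_lin.
have etaf (xi : 'Hom(U', k^o)) : eta xi = (xi \o f)%VF.
  apply/lfunP => v; rewrite comp_lfunE fE /fv linear_sum -etahE.
  rewrite {1}(dual_sum xi) linear_sum sum_lfunE; apply: eq_bigr => i _.
  by rewrite !linearZ scale_lfunE /= /GRing.scale /= mulrC.
have [b0 b0E] := qd_gr1 (ch_a_gr g).
(* The degree 1 component of a dual morphism is minus the scalar part. *)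
pose b : 'Hom(U, k^o) := - (b0 : 'Hom(U, k^o)).
have gb : ch_a g = - qd_pi D (tgen (b : dual U)).
  by rewrite -b0E /b !linearN opprK.
have gf (xi : 'Hom(U', k^o)) : ch_f g (qd_pi D' (tgen (xi : dual U'))) =
    qd_pi D (tgen ((xi \o f)%VF : dual U)).
  by rewrite -etaE etaf.
have [phi [c [phi_hP dE hE]]] := qd_dh D.
have [phi' [c' [phi_hP' dE' hE']]] := qd_dh D'.
have fI p := dual_mor_relI gf (p := p).
have phiE := proj1 (dual_mor_d_gen b gf dE dE' fI).
have cE := proj1 (dual_mor_h b gf dE hE hE' fI).
have [|F Ff] := @affine_on_exists f b.
  apply: (proj2 (affine_relJ2 phi_hP phi_hP' f b)) => p Ip.
  split; first exact: fI.
    apply: phiE => // xi; rewrite -gb; apply: ch_d.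
    exact: (presents_gen_gr1 (qd_pres D')).
  by apply: cE => //; rewrite -gb; apply: ch_h.
by exists F, f, b.
Qed.
End Morphisms.

(** * Identities and composition of dual morphisms *)

Lemma is_dual_mor_id (k : fieldType) (A : wqls k) (V : hyperplane A)
    (D : qls_dual V) : is_dual_mor D D (wqls_id A) (cdg_id D).
Proof.
exists \1%VF, 0; split=> [v|xi|] /=.
- by rewrite lfunE /= lfunE scale0r addr0.
- by rewrite comp_lfun1r.
rewrite [tgen _](linear0 (@tgen k (dual (hp_space V)))) (linear0 (qd_pi D)).
by rewrite oppr0.
Qed.

Lemma is_dual_mor_comp (k : fieldType) (A B C : wqls k) (V : hyperplane A)
    (V' : hyperplane B) (V'' : hyperplane C) (D : qls_dual V) (D' : qls_dual V')
    (D'' : qls_dual V'') (G : wqls_hom B C) (F : wqls_hom A B)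
    (gG : cdg_hom D'' D') (gF : cdg_hom D' D) :
  is_dual_mor D' D'' G gG -> is_dual_mor D D' F gF ->
  is_dual_mor D D'' (wqls_comp G F) (cdg_comp gF gG).
Proof.
move=> [f' [b' [Gf gf' gb']]] [f [b [Ff gf gb]]].
(* Applying [G] to f(v) + b(v) gives f'(f(v)) + b'(f(v)) + b(v), since [G] fixes the scalars. *)
exists (f' \o f)%VF, (b + (b' \o f)%VF); split=> [v|xi|] /=.
- rewrite Ff linearD linearZ /= rmorph1 Gf comp_lfunE add_lfunE comp_lfunE.
  by rewrite scalerDl -addrA; congr (_ + _); apply: addrC.
- by rewrite gf' gf comp_lfunA.
rewrite gb gb' rmorphN /= gf -opprD; congr (- _).
by rewrite !linearD.
Qed.

(** * Quadratic algebras and cubic functionals *)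

Lemma seq_span_subspace (k : fieldType) (M : lmodType k) (s : seq M) :
  subspace (fun x => exists c : nat -> k, x = \sum_(i < size s) c i *: s`_i).
Proof.
split=> [|a _ _ [c ->] [d ->]].
  by exists (fun=> 0); rewrite big1 // => i _; rewrite scale0r.
exists (fun i => a * c i + d i); rewrite scaler_sumr -big_split.
by apply: eq_bigr => i _ /=; rewrite scalerDl scalerA.
Qed.

Lemma seq_span_mem (k : fieldType) (M : lmodType k) (s : seq M) x :
  x \in s -> exists c : nat -> k, x = \sum_(i < size s) c i *: s`_i.
Proof.
move=> sx; have lt_xs : (index x s < size s)%N by rewrite index_mem.
exists (fun i => (i == index x s)%:R); rewrite (bigD1 (Ordinal lt_xs)) //=.
rewrite eqxx scale1r nth_index // big1 ?addr0 // => i.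
by rewrite -val_eqE /= => /negPf ->; rewrite scale0r.
Qed.

Section TensorComponents.
Variables (k : fieldType) (U : vectType k) (n : nat).
Local Notation T := (tensor U).
Local Notation letter := 'I_(\dim (fullv : {vspace U})).

Lemma tdeg_comb (x : T) : tdeg n x ->
  exists s : n.-tuple letter -> k, x = \sum_t s t *: word t.
Proof.
move=> degx; rewrite [x]tensorE big_seq_cond.
pose wt (t : n.-tuple letter) : T := word t.
apply: (subspace_sum (comb_subspace wt)) => m /andP[/degx degm _].
apply: (subspaceZ _ (comb_subspace wt)).
have /eqP sizem : size (m : seq letter) = n by rewrite -fdegE.
exists (fun t => (t == Tuple sizem)%:R).
rewrite (bigD1 (Tuple sizem) isT) /= eqxx scale1r big1 ?addr0 // => t /negPf ->.
by rewrite scale0r.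
Qed.

(** Words of length [n] form a finite basis of degree [n]; a functional on their span is extended by
    0 to words of other lengths. *)
Lemma tdeg_separation (S : T -> Prop) (x : T) : subspace S -> tdeg n x ->
  (forall L : {linear T -> k^o}, (forall y, tdeg n y -> S y -> L y = 0) ->
     L x = 0) ->
  S x.
Proof.
move=> subS /tdeg_comb[s ->] sepx.
apply: (double_annihilator (e := fun t : n.-tuple letter => word t) subS) => y annS.
pose h (w : seq letter) : k^o := if insub w is Some t then y t else 0.
have hE (r : n.-tuple letter -> k) :
    word_ext h (\sum_t r t *: word t) = \sum_t r t * y t.
  rewrite linear_sum; apply: eq_bigr => t _; rewrite linearZ /= word_ext_word.
  by rewrite /h valK.
rewrite -hE; apply: sepx => z /tdeg_comb[r ->] Sr.
exact: (etrans (hE r) (annS r Sr)).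
Qed.
End TensorComponents.

(** The grading consists of the images of T^n(U). It is direct because the ideal is homogeneous, and
    the quotient is nonzero because the ideal starts in degree 2. *)
Lemma quadratic_algebra (k : fieldType) (U : vectType k) (S : tensor U -> Prop) :
  subspace S -> (forall s, S s -> tdeg 2 s) ->
  exists (B : algType k) (gr : nat -> B -> Prop) (pi : {lrmorphism tensor U -> B}),
    is_grading gr /\ presents gr S pi.
Proof.
move=> subS S2; have [B [pi [surj ker]]] := quotient_algebra (ideal_gen1 S2 subS).
pose gr n (b : B) := exists2 t, tdeg n t & pi t = b.
exists B, gr, pi; split; last first.
  by split=> // u; exists (tgen u) => //; apply: tdeg_gen.
split.
- move=> n; split=> [|a _ _ [s degs <-] [t degt <-]].
    by exists 0; [case: (@tdeg_subspace k U n) | rewrite linear0].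
  exists (a *: s + t); last exact: linearP.
  exact: (proj2 (@tdeg_subspace k U n)).
- move=> n; pose s := [seq pi (word (t : n.-tuple _)) | t <- enum {: n.-tuple _}].
  exists s => _ [t /tdeg_comb[c ->] <-]; rewrite linear_sum.
  apply: (subspace_sum (seq_span_subspace s)) => i _; rewrite linearZ.
  apply: (subspaceZ _ (seq_span_subspace s)); apply: seq_span_mem.
  by apply/mapP; exists i; rewrite ?mem_enum.
- by exists 1; [apply: tdeg1 | apply: rmorph1].
- move=> m n _ _ [s degs <-] [t degt <-]; exists (s * t); last exact: rmorphM.
  exact: tdegM.
- move=> x; have [t <-] := surj x; have [N tE] := hcomp_sum t.
  exists N, (fun i => pi (hcomp i t)); split=> [i|].
    by exists (hcomp i t) => //; apply: tdeg_hcomp.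
  by rewrite {1}tE linear_sum.
move=> N c gr_c sum0 j ltjN.
have lift i : exists t, tdeg i t /\ pi t = c i by have [t] := gr_c i; exists t.
pose t i := sval (constructive_indefinite_description _ (lift i)).
have tP i : tdeg i (t i) /\ pi (t i) = c i.
  by rewrite /t; case: constructive_indefinite_description.
rewrite -(proj2 (tP j)); apply/ker.
(* The sum of the homogeneous lifts lies in the ideal, hence so does each of its components. *)
have -> : t j = hcomp j (\sum_(i < N) t i).
  rewrite linear_sum (bigD1 (Ordinal ltjN)) //= (hcomp_id j (proj1 (tP j))) eqxx.
  rewrite big1 ?addr0 // => i; rewrite -val_eqE /= => ne.
  by rewrite (hcomp_id j (proj1 (tP i))) (negPf ne).
apply/(ideal_gen_hcomp S2)/ker; rewrite linear_sum -[RHS]sum0.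
by apply: eq_bigr => i _; case: (tP i).
Qed.

Section AlgebraSums.
Variables (k : fieldType) (A : algType k) (J : finType) (e : J -> A).

Lemma triple_sum (l : J -> J -> J -> k) :
  \sum_c (\sum_(t : J * J) l t.1 t.2 c *: (e t.1 * e t.2)) * e c =
  \sum_a e a * (\sum_(t : J * J) l a t.1 t.2 *: (e t.1 * e t.2)).
Proof.
transitivity (\sum_c \sum_a \sum_b l a b c *: (e a * e b * e c)).
  apply: eq_bigr => c _; rewrite mulr_suml pair_bigA.
  by apply: eq_bigr => t _; rewrite -scalerAl.
rewrite exchange_big; apply: eq_bigr => a _.
rewrite exchange_big pair_bigA mulr_sumr; apply: eq_bigr => t _ /=.
by rewrite -scalerAr mulrA.
Qed.

Lemma linear_suml (L : {linear A -> k^o}) (s : J -> k) y :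
  L ((\sum_j s j *: e j) * y) = \sum_j s j * L (e j * y).
Proof.
rewrite mulr_suml linear_sum; apply: eq_bigr => j _.
by rewrite -scalerAl linearZ.
Qed.

Lemma linear_sumr (L : {linear A -> k^o}) (s : J -> k) y :
  L (y * \sum_j s j *: e j) = \sum_j s j * L (y * e j).
Proof.
rewrite mulr_sumr linear_sum; apply: eq_bigr => j _.
by rewrite -scalerAr linearZ.
Qed.
End AlgebraSums.

Section CubicFunctional.
Variables (k : fieldType) (U : vectType k).
Local Notation T := (tensor U).
Local Notation Td := (tensor (dual U)).
Local Notation letter := 'I_(\dim (fullv : {vspace U})).
Local Notation e := (@ebasis k U).
Local Notation dgen := (@dgen k U).
Variable L : {linear Td -> k^o}.

(* L is a functional on T^3(U* ), i.e. an element of T^3(U); cubic_r c and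
   cubic_l a are its slices in T^2(U). *)
Definition cubic_r (c : letter) : T :=
  \sum_(t : letter * letter) L (dgen2 t * dgen c) *: gen2 t.
Definition cubic_l (a : letter) : T :=
  \sum_(t : letter * letter) L (dgen a * dgen2 t) *: gen2 t.

Lemma gen2_sum_deg (s : letter * letter -> k) : tdeg 2 (\sum_t s t *: gen2 t).
Proof.
apply: (subspace_sum (@tdeg_subspace k U 2)) => t _.
by apply: (subspaceZ _ (@tdeg_subspace k U 2)); apply: tdeg2_gen.
Qed.

Lemma pairing_cubic_r x c : tdeg 2 x -> pairing x (cubic_r c) = L (x * dgen c).
Proof.
move=> /tdeg2_dcomb[s ->]; rewrite /cubic_r pairing_comb.
exact (esym (linear_suml _ L s _)).
Qed.

Lemma pairing_cubic_l x a : tdeg 2 x -> pairing x (cubic_l a) = L (dgen a * x).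
Proof.
move=> /tdeg2_dcomb[s ->]; rewrite /cubic_l pairing_comb.
exact (esym (linear_sumr _ L s _)).
Qed.

Lemma dual_tgen (xi : 'Hom(U, k^o)) :
  tgen (xi : dual U) = \sum_i xi (e i) *: dgen i.
Proof.
rewrite {1}(dual_sum xi) (linear_sum (@tgen k (dual U))).
by apply: eq_bigr => i _; rewrite linearZ.
Qed.

Lemma cubic_genr x (xi : 'Hom(U, k^o)) : tdeg 2 x ->
  L (x * tgen (xi : dual U)) = \sum_c xi (e c) * pairing x (cubic_r c).
Proof.
move=> degx; rewrite (dual_tgen xi); apply: (etrans (linear_sumr _ L _ _)).
by apply: eq_bigr => c _; rewrite pairing_cubic_r.
Qed.

Lemma cubic_genl x (xi : 'Hom(U, k^o)) : tdeg 2 x ->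
  L (tgen (xi : dual U) * x) = \sum_a xi (e a) * pairing x (cubic_l a).
Proof.
move=> degx; rewrite (dual_tgen xi); apply: (etrans (linear_suml _ L _ _)).
by apply: eq_bigr => c _; rewrite pairing_cubic_l.
Qed.

(** Both sums are the cubic tensor L itself, written once with its last and once with its first
    factor split off. *)
Lemma cubic_slices :
  \sum_c cubic_r c * tgen (e c) = \sum_a tgen (e a) * cubic_l a.
Proof.
pose l a b c := L (dgen a * dgen b * dgen c).
apply: (etrans (triple_sum (fun i => tgen (e i)) l)).
apply: eq_bigr => a _; apply: (congr1 (fun z => tgen (e a) * z)).
apply: eq_bigr => t _; apply: (congr1 (fun z => z *: gen2 t)).
exact (congr1 L (esym (mulrA (dgen a) (dgen t.1) (dgen t.2)))).
Qed.

Variable I : T -> Prop.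
Hypotheses (subI : subspace I) (I2 : forall p, I p -> tdeg 2 p).
Hypothesis LI : forall x, tdeg 3 x -> ideal_gen (annihilator I) x -> L x = 0.

(** Since [L] kills I^perp (x) U^*, the slice is annihilated by all of I^perp and so lies in I. *)
Lemma cubic_r_in c : I (cubic_r c).
Proof.
apply: (annihilatorK subI I2) => [|x annx]; first exact: gen2_sum_deg.
have degx := proj1 annx; rewrite (pairing_cubic_r c degx); apply: LI.
  exact: (tdegM degx (@tdeg_gen k (dual U) _)).
exact/ideal_genMr/ideal_gen_mem.
Qed.

Lemma cubic_l_in a : I (cubic_l a).
Proof.
apply: (annihilatorK subI I2) => [|x annx]; first exact: gen2_sum_deg.
have degx := proj1 annx; rewrite (pairing_cubic_l a degx); apply: LI.
  exact: (tdegM (@tdeg_gen k (dual U) _) degx).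
exact/ideal_genMl/ideal_gen_mem.
Qed.
End CubicFunctional.

(** * Generalized Jacobi relations of a cubic tensor *)

Lemma addr_regroup0 (M : zmodType) (x y z t : M) :
  x + z = y + t -> x - y + ((z - t) + 0) = 0.
Proof. by move=> eq_xz; rewrite addr0 addrACA -opprD eq_xz subrr. Qed.

Section JacobiRelations.
Variables (k : fieldType) (A : wqls k) (V : hyperplane A).
Local Notation U := (hp_space V).
Local Notation T := (tensor U).
Local Notation Td := (tensor (dual U)).
Local Notation letter := 'I_(\dim (fullv : {vspace U})).
Local Notation e := (@ebasis k U).
Local Notation I := (@relI k A (wq_W A) (wq_inc A) (sval V)).
Local Notation J2 := (@relJ2 k A (wq_W A) (wq_inc A) (sval V)).
Local Notation ev := (evalT (wq_inc A) (sval V)).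
Local Notation hinc := (@hp_inc k A V).
Local Notation idealI := (ideal_gen (annihilator I)).
Variables (phi : T -> U) (c : T -> k).
Hypothesis phi_hP : is_phi_h phi c.

Lemma evalT_relI p : I p -> ev p = - (hinc (phi p) + (c p)%:A).
Proof.
move=> /(phi_h_mem phi_hP)[_ Jp]; apply/eqP; rewrite -addr_eq0 -evalT_low2.
exact/eqP.
Qed.

Section Functional.
Variable L : {linear Td -> k^o}.
Hypothesis LI : forall x, tdeg 3 x -> idealI x -> L x = 0.
Local Notation Yr := (cubic_r L).
Local Notation Yl := (cubic_l L).

(** The value at L of phi (x) id - id (x) phi, with [jacobi1] the analogue for c. For an enveloping
    algebra phi is minus the bracket on skew tensors, c is 0, and [phi jacobi2 = jacobi1] is the
    Jacobi identity. *)
Definition jacobi2 : T :=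
  \sum_i tgen (phi (Yr i)) * tgen (e i) - \sum_i tgen (e i) * tgen (phi (Yl i)).
Definition jacobi1 : U := \sum_i c (Yr i) *: e i - \sum_i c (Yl i) *: e i.

Lemma jacobi2_deg : tdeg 2 jacobi2.
Proof.
apply: (subspaceB (@tdeg_subspace k U 2)).
  by apply: (subspace_sum (@tdeg_subspace k U 2)) => i _; apply: tdeg2_gen.
by apply: (subspace_sum (@tdeg_subspace k U 2)) => i _; apply: tdeg2_gen.
Qed.

(* Both groupings of the cubic tensor L have the same image in A. *)
Lemma jacobi_relJ2 : J2 (low2 jacobi2 jacobi1 0).
Proof.
split; first exact/tfilt_low2/jacobi2_deg.
have YrI := cubic_r_in (relI_subspace V) (@relI_deg _ _ V) LI.
have YlI := cubic_l_in (relI_subspace V) (@relI_deg _ _ V) LI.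
have evM u v : ev (tgen u * tgen v) = hinc u * hinc v.
  by rewrite rmorphM; congr (_ * _); apply: evalT_gen.
have ev2 : ev jacobi2 = \sum_i hinc (phi (Yr i)) * hinc (e i) -
                        \sum_i hinc (e i) * hinc (phi (Yl i)).
  apply: (etrans (linearB ev _ _)); congr (_ - _).
    by apply: (etrans (linear_sum ev _ _ _)); apply: eq_bigr => i _; apply: evM.
  by apply: (etrans (linear_sum ev _ _ _)); apply: eq_bigr => i _; apply: evM.
have hinc1 : hinc jacobi1 = \sum_i c (Yr i) *: hinc (e i) -
                            \sum_i c (Yl i) *: hinc (e i).
  apply: (etrans (linearB hinc _ _)); congr (_ - _).
    by apply: (etrans (linear_sum hinc _ _ _)); apply: eq_bigr => i _; rewrite linearZ.
  by apply: (etrans (linear_sum hinc _ _ _)); apply: eq_bigr => i _; rewrite linearZ.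
have evr : ev (\sum_i Yr i * tgen (e i)) = - (\sum_i
    (hinc (phi (Yr i)) * hinc (e i) + c (Yr i) *: hinc (e i))).
  rewrite -sumrN; apply: (etrans (linear_sum ev _ _ _)); apply: eq_bigr => i _.
  rewrite rmorphM /= (evalT_gen (e i)) (evalT_relI (YrI i)).
  by rewrite mulNr mulrDl mulr_algl.
have evl : ev (\sum_i tgen (e i) * Yl i) = - (\sum_i
    (hinc (e i) * hinc (phi (Yl i)) + c (Yl i) *: hinc (e i))).
  rewrite -sumrN; apply: (etrans (linear_sum ev _ _ _)); apply: eq_bigr => i _.
  rewrite rmorphM /= (evalT_gen (e i)) (evalT_relI (YlI i)).
  by rewrite mulrN mulrDr mulr_algr.
apply: (etrans (evalT_low2 _ _ _)).
apply: (etrans (congr2 +%R ev2 (congr2 +%R hinc1 (scale0r 1)))).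
apply: addr_regroup0; rewrite -[LHS]big_split -[RHS]big_split /=.
exact (oppr_inj (etrans (esym evr) (etrans (congr1 ev (cubic_slices L)) evl))).
Qed.

(** Read off from the relation by uniqueness of lower terms. The three clauses give, in order,
    stability of the ideal under [d], the formula for d^2, and d(h) = 0. *)
Lemma jacobiP : [/\ I jacobi2, phi jacobi2 = jacobi1 & c jacobi2 = 0].
Proof. exact: (phi_h_low2 phi_hP jacobi2_deg jacobi_relJ2). Qed.

Variables (delta : {linear dual U -> Td}) (d : {linear Td -> Td}).
Hypothesis delta_deg : forall xi, tdeg 2 (delta xi).
Hypothesis deltaE : forall (xi : 'Hom(U, k^o)) p, I p ->
  pairing (delta (xi : dual U)) p = xi (phi p).
Hypothesis d_gen : forall xi, d (tgen xi) = delta xi.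
Hypothesis dM : forall x y, d (x * y) = d x * y + tsign x * d y.

Lemma pairing_jacobi2 (xi eta : 'Hom(U, k^o)) :
  pairing (tgen (xi : dual U) * tgen (eta : dual U)) jacobi2 =
  \sum_i xi (phi (Yr i)) * eta (e i) - \sum_i xi (e i) * eta (phi (Yl i)).
Proof.
pose P := pairr (tgen (xi : dual U) * tgen (eta : dual U)).
apply: (etrans (linearB P _ _)); congr (_ - _).
  apply: (etrans (linear_sum P _ _ _)); apply: eq_bigr => i _.
  exact (pairingE xi eta (phi (Yr i)) (e i)).
apply: (etrans (linear_sum P _ _ _)); apply: eq_bigr => i _.
exact (pairingE xi eta (e i) (phi (Yl i))).
Qed.

(* d is dual to the map L |-> jacobi2 *)
Lemma cubic_derivation x : tdeg 2 x -> L (d x) = pairing x jacobi2.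
Proof.
have YrI := cubic_r_in (relI_subspace V) (@relI_deg _ _ V) LI.
have YlI := cubic_l_in (relI_subspace V) (@relI_deg _ _ V) LI.
move: x; apply: (tdeg2_ind (equalizer_subspace (L \o d) (pairl jacobi2))) => i j.
rewrite [RHS]pairing_jacobi2 /=.
have -> : d (tgen (ebasis i) * tgen (ebasis j)) =
    delta (ebasis i) * tgen (ebasis j) - tgen (ebasis i) * delta (ebasis j).
  by rewrite dM !d_gen tsign_gen mulNr.
rewrite linearB; congr (_ - _).
  apply: (etrans (cubic_genr L (ebasis j) (@delta_deg (ebasis i)))).
  apply: eq_bigr => l _.
  by rewrite (deltaE _ (YrI l)) mulrC.
apply: (etrans (cubic_genl L (ebasis i) (@delta_deg (ebasis j)))).
apply: eq_bigr => l _.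
by rewrite (deltaE _ (YlI l)).
Qed.

Lemma cubic_d_ann s : annihilator I s -> L (d s) = 0.
Proof.
move=> [degs anns]; rewrite cubic_derivation //; apply: anns.
by case: jacobiP.
Qed.

Variable eta : Td.
Hypotheses (eta_deg : tdeg 2 eta) (etaE : forall p, I p -> pairing eta p = c p).

(** Both parts evaluate to [xi jacobi1]: the first through phi of [jacobi2], the commutator by
    pairing [eta] with the slices of [L], on which it takes the values of c. *)
Lemma cubic_dd (xi : 'Hom(U, k^o)) :
  L (d (delta (xi : dual U)) -
     (eta * tgen (xi : dual U) - tgen (xi : dual U) * eta)) = 0.
Proof.
have YrI := cubic_r_in (relI_subspace V) (@relI_deg _ _ V) LI.
have YlI := cubic_l_in (relI_subspace V) (@relI_deg _ _ V) LI.
have [I2 phi2 _] := jacobiP.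
have Ed : L (d (delta (xi : dual U))) = xi jacobi1.
  exact (etrans (cubic_derivation (@delta_deg xi)) (etrans (deltaE xi I2)
    (congr1 xi phi2))).
have E1 : xi jacobi1 = \sum_i xi (e i) * pairing eta (Yr i) -
                       \sum_i xi (e i) * pairing eta (Yl i).
  apply: (etrans (linearB xi _ _)); congr (_ - _).
    apply: (etrans (linear_sum xi _ _ _)); apply: eq_bigr => i _.
    by rewrite linearZ (etaE (YrI i)) mulrC.
  apply: (etrans (linear_sum xi _ _ _)); apply: eq_bigr => i _.
  by rewrite linearZ (etaE (YlI i)) mulrC.
have Ec := congr2 (fun x y : k^o => x - y) (cubic_genr L xi eta_deg)
  (cubic_genl L xi eta_deg).
have Eb := congr2 (fun x y : k^o => x - y) (etrans Ed E1) (etrans (linearB L _ _) Ec).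
exact (etrans (linearB L _ _) (etrans Eb (subrr _))).
Qed.

Lemma cubic_dh : L (d eta) = 0.
Proof. have [I2 _ c0] := jacobiP.
exact (etrans (cubic_derivation eta_deg) (etrans (etaE I2) c0)). Qed.
End Functional.
End JacobiRelations.

(** * Existence of the dual *)

Lemma scaler_signr (k : fieldType) (A : algType k) n (x : A) :
  (-1) ^+ n *: x = (-1) ^+ n * x.
Proof.
rewrite -signr_odd -[in RHS]signr_odd.
by case: (odd n); rewrite ?scaleN1r ?mulN1r ?scale1r ?mul1r.
Qed.

Lemma leibniz_ker (k : fieldType) (A B : algType k) (pi : {lrmorphism A -> B})
    (d : {linear A -> A}) (sg : {lrmorphism A -> A}) a s b :
  (forall x y, d (x * y) = d x * y + sg x * d y) ->
  pi s = 0 -> pi (d s) = 0 -> pi (sg s) = 0 -> pi (d (a * s * b)) = 0.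
Proof.
move=> dM pis pids pisg; rewrite !dM linearD !rmorphM /= linearD !rmorphM /=.
by rewrite pis pids pisg !(mulr0, mul0r, addr0).
Qed.

Lemma leibniz_pi (k : fieldType) (A B : algType k) (pi : {lrmorphism A -> B})
    (d : {linear A -> A}) (sg : {lrmorphism A -> A}) x y (a : k) :
  (forall x y, d (x * y) = d x * y + sg x * d y) -> sg x = a *: x ->
  pi (d (x * y)) = pi (d x) * pi y + a *: (pi x * pi (d y)).
Proof.
by move=> dM sgx; rewrite dM sgx linearD !rmorphM /= linearZ /= -scalerAl.
Qed.

Lemma rmorph_commutator (k : fieldType) (A B : algType k)
    (pi : {lrmorphism A -> B}) z h v :
  pi (z - (h * v - v * h)) = 0 -> pi z = pi h * pi v - pi v * pi h.
Proof. by move=> h0; apply: subr0_eq; rewrite -h0 !linearB /= !rmorphM. Qed.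

Lemma scomm2E (k : fieldType) (B : algType k) n (h x : B) :
  scomm 2 n h x = h * x - x * h.
Proof. by rewrite /scomm exprM sqrrN !expr1n mul1r. Qed.

Section QuotientDerivation.
Variables (k : fieldType) (U : vectType k) (S : tensor U -> Prop).
Hypotheses (subS : subspace S) (S2 : forall s, S s -> tdeg 2 s).
Variables (B : algType k) (gr : nat -> B -> Prop) (pi : {lrmorphism tensor U -> B}).
Hypotheses (grP : is_grading gr) (pres : presents gr S pi).
Variables (delta : {linear U -> tensor U}) (d : {linear tensor U -> tensor U}).
Hypothesis delta_deg : forall u, tdeg 2 (delta u).
Hypothesis d_gen : forall u, d (tgen u) = delta u.
Hypothesis dM : forall x y, d (x * y) = d x * y + tsign x * d y.

Lemma derivation1 : d 1 = 0.
Proof.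
have := dM 1 1; rewrite rmorph1 !mulr1 mul1r => d1.
by apply: (addrI (d 1)); rewrite -d1 addr0.
Qed.

Lemma derivation_deg n x : tdeg n x -> tdeg n.+1 (d x).
Proof.
apply: (tdeg_ind (P := fun n x => tdeg n.+1 (d x))) => [m||m i y degy IHy].
- split=> [|a y z degy degz].
    by rewrite linear0; case: (@tdeg_subspace k U m.+1).
  by rewrite linearP; apply: (proj2 (@tdeg_subspace k U m.+1)).
- by rewrite derivation1; case: (@tdeg_subspace k U 1).
rewrite dM d_gen tsign_gen mulNr.
apply: (subspaceB (@tdeg_subspace k U m.+2)).
  exact: (tdegM (@delta_deg (ebasis i)) degy).
exact: (tdegM (@tdeg_gen k U (ebasis i)) IHy).
Qed.

Hypothesis dS : forall s, S s -> ideal_gen S (d s).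

Lemma pi_ideal x : ideal_gen S x -> pi x = 0.
Proof. by have [_ _ ker] := pres => /ker. Qed.

(** In the Leibniz expansion of [d (a * s * b)] every term contains [s], [tsign s] or [d s], all of
    which vanish in the quotient. *)
Lemma derivation_ideal x : ideal_gen S x -> pi (d x) = 0.
Proof.
elim/ideal_gen_min => [|y z dy dz|a s b Ss]; first by rewrite !linear0.
  by rewrite !linearD /= dy dz addr0.
have pis : pi s = 0 by apply/pi_ideal/ideal_gen_mem.
have pids : pi (d s) = 0 by apply/pi_ideal/dS.
have pisign : pi (tsign s) = 0.
  by rewrite (tsign_deg (S2 Ss)) linearZ /= pis scaler0.
exact (leibniz_ker a b dM pis pids pisign).
Qed.

Variable eta : tensor U.
Hypotheses (eta_deg : tdeg 2 eta) (d_eta : ideal_gen S (d eta)).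
Hypothesis dd_gen : forall u,
  ideal_gen S (d (delta u) - (eta * tgen u - tgen u * eta)).

Lemma quotient_derivation : exists dB : {linear B -> B},
  [/\ forall t, dB (pi t) = pi (d t),
      forall n x, gr n x -> gr n.+1 (dB x),
      forall n x y, gr n x -> dB (x * y) = dB x * y + (-1) ^+ n * (x * dB y),
      forall n x, gr n x -> dB (dB x) = scomm 2 n (pi eta) x
    & dB (pi eta) = 0].
Proof.
have surj := presents_surj pres.
have [_ _ ker] := pres.
have [dB dBE] : exists dB : {linear B -> B}, forall t, dB (pi t) = (pi \o d) t.
  by apply: (descend_linear surj (g := pi \o d)) => t /ker; apply: derivation_ideal.
have dB_gr n x : gr n x -> gr n.+1 (dB x).
  move=> /(presents_homog grP pres)[t degt <-]; rewrite dBE.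
  exact/(presents_deg grP pres)/derivation_deg.
have dBM n x y : gr n x -> dB (x * y) = dB x * y + (-1) ^+ n * (x * dB y).
  move=> /(presents_homog grP pres)[t degt <-]; have [s <-] := surj y.
  rewrite -(rmorphM pi); apply: (etrans (dBE _)).
  apply: (etrans (leibniz_pi pi s dM (tsign_deg degt))).
  by rewrite (dBE t) (dBE s) scaler_signr.
exists dB; split=> //; last by rewrite dBE; apply: pi_ideal.
have dB1 : dB 1 = 0 by rewrite -(rmorph1 pi) dBE /= derivation1 linear0.
(* The square of an odd derivation is an ordinary derivation, as its two mixed terms cancel, and so
   is the commutator with the even element [pi eta]; hence generators suffice. *)
apply: (presents_ind grP pres (P := fun n x => dB (dB x) = scomm 2 n (pi eta) x)).
- by move=> n; apply: (equalizer_subspace (dB \o dB) (scomm 2 n (pi eta))).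
- by rewrite dB1 linear0 /scomm muln0 mulr1 !mul1r subrr.
move=> n u y gry IHy; have gru := presents_gen_gr1 pres u.
have ddu : dB (dB (pi (tgen u))) = pi eta * pi (tgen u) - pi (tgen u) * pi eta.
  rewrite (dBE (tgen u)) /= d_gen dBE /=.
  exact (rmorph_commutator (pi_ideal (dd_gen u))).
move: (pi (tgen u)) (pi eta) gru ddu IHy => v h gru ddu IHy.
rewrite (dBM _ _ _ gru) linearD (dBM _ _ _ (dB_gr _ _ gru)) !mulN1r linearN.
rewrite (dBM _ _ _ gru) /= IHy ddu !scomm2E.
rewrite sqrrN expr1n mul1r expr1 mulN1r opprD opprK addrA addrK.
by rewrite mulrBl mulrBr !mulrA addrA subrK.
Qed.
End QuotientDerivation.

Section Existence.
Variables (k : fieldType) (A : wqls k) (V : hyperplane A).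
Local Notation U := (hp_space V).
Local Notation T := (tensor U).
Local Notation Td := (tensor (dual U)).
Local Notation I := (@relI k A (wq_W A) (wq_inc A) (sval V)).
Local Notation idealI := (ideal_gen (annihilator I)).

(** A lift of phi^* from I^* to tensors of degree 2, chosen on the dual basis and extended linearly,
    so that the lift itself is linear. *)
Lemma transpose_exists (phi : T -> U) : linear_on I phi ->
  exists delta : {linear dual U -> Td},
    (forall xi, tdeg 2 (delta xi)) /\
    forall (xi : 'Hom(U, k^o)) p, I p -> pairing (delta (xi : dual U)) p = xi (phi p).
Proof.
move=> phi_lin; have lift i : exists x : Td, tdeg 2 x /\
    forall p, I p -> pairing x p = dcoord i (phi p).
  have [|x degx xE] := pairing_represents (relI_subspace V) (@relI_deg _ _ V)
    (g := fun p => dcoord i (phi p)); last by exists x.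
  by move=> a x y Ix Iy; rewrite phi_lin // linearP.
pose x i := sval (constructive_indefinite_description _ (lift i)).
have xP i : tdeg 2 (x i) /\ forall p, I p -> pairing (x i) p = dcoord i (phi p).
  by rewrite /x; case: constructive_indefinite_description.
pose h (xi : dual U) : Td := \sum_i (xi : 'Hom(U, k^o)) (ebasis i) *: x i.
have h_lin : linear h.
  move=> a y z; rewrite /h scaler_sumr -big_split; apply: eq_bigr => i _ /=.
  by rewrite add_lfunE scale_lfunE scalerDl scalerA.
pose delta := HB.pack_for {linear dual U -> Td} h
  (GRing.isLinear.Build _ _ _ _ h h_lin).
exists delta; split=> [xi|xi p Ip].
  apply: (subspace_sum (@tdeg_subspace k (dual U) 2)) => i _.
  by apply: (subspaceZ _ (@tdeg_subspace k (dual U) 2)); case: (xP i).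
apply: (etrans (linear_sum (pairl p) _ _ _)).
rewrite [in RHS](ebasis_sum (phi p)) linear_sum; apply: eq_bigr => i _.
rewrite !linearZ -dcoordE -(proj2 (xP i) p Ip).
exact: mulrC.
Qed.

Lemma ideal_separation x : tdeg 3 x ->
  (forall L : {linear Td -> k^o},
     (forall y, tdeg 3 y -> idealI y -> L y = 0) -> L x = 0) ->
  idealI x.
Proof. exact: (tdeg_separation (ideal_gen_subspace _)). Qed.

Lemma qls_dual_exists : inhabited (qls_dual V).
Proof.
have subS := ann_sub V; have S2 := @ann_deg k A V.
have [phi [c phi_hP]] := phi_h_exists V; have [phi_lin c_lin _] := phi_hP.
have [delta [delta_deg deltaE]] := transpose_exists phi_lin.
have [eta eta_deg etaE] := pairing_represents (relI_subspace V) (@relI_deg _ _ V) c_lin.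
(* This [d] depends on the lift [delta]; the CDG identities are claimed for it only modulo the
   ideal. *)
have [d [d_gen dM]] := tensor_derivation idfun delta.
have d_deg := derivation_deg delta_deg d_gen dM.
have dS s : annihilator I s -> idealI (d s).
  move=> anns; apply: ideal_separation => [|L LI]; first exact: d_deg (proj1 anns).
  exact: (cubic_d_ann phi_hP LI delta_deg deltaE d_gen dM anns).
have d_eta : idealI (d eta).
  apply: ideal_separation => [|L LI]; first exact: d_deg.
  exact: (cubic_dh phi_hP LI delta_deg deltaE d_gen dM eta_deg etaE).
have dd_gen xi : idealI (d (delta xi) - (eta * tgen xi - tgen xi * eta)).
  apply: ideal_separation => [|L LI].
    apply: (subspaceB (@tdeg_subspace k (dual U) 3)); first exact: d_deg.
    apply: (subspaceB (@tdeg_subspace k (dual U) 3)).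
      exact: (tdegM eta_deg (@tdeg_gen k (dual U) xi)).
    exact: (tdegM (@tdeg_gen k (dual U) xi) eta_deg).
  exact: (cubic_dd phi_hP LI delta_deg deltaE d_gen dM eta_deg etaE xi).
have [B [gr [pi [grP pres]]]] := quadratic_algebra subS S2.
have [dB [dBE dB_gr dBM dB_dd dB_h]] :=
  quotient_derivation S2 grP pres delta_deg d_gen dM dS d_eta dd_gen.
pose C := MkCDG grP dB_gr dBM (presents_deg grP pres eta_deg) dB_dd dB_h.
have quadC : is_quadratic (@cdg_gr k C) by exists (dual U), (annihilator I), pi.
split; apply: (@MkQLSDual k A V (MkQCDG quadC) pi pres).
exists phi, c; split=> // [xi|]; last by exists eta.
exists (delta xi); split; [exact: delta_deg | | exact: deltaE].
by rewrite -d_gen -dBE.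
Qed.
End Existence.

Theorem mainTheorem3 (k : fieldType) :
  (forall (A : WQLS k) (V : hyperplane A), inhabited (qls_dual V)) /\
  (forall (V : forall A : WQLS k, hyperplane A)
          (D : forall A : WQLS k, qls_dual (V A)),
    exists DF : @contra_functor (WQLS k) (QCDG k) (fun A => D A),
      (forall (A A' : WQLS k) (F : mor A A'),
         is_dual_mor (D A) (D A') F (fmap DF F)) /\
      fully_faithful DF).
Proof.
split=> [A V|V D]; first exact: qls_dual_exists.
(* A dual of [F] is picked by choice, but it is unique; functoriality therefore reduces to
   identities and composites being dual to identities and composites. *)
pose Dmor (A A' : wqls k) (F : wqls_hom A A') :=
  sval (constructive_indefinite_description _ (is_dual_mor_exists (D A) (D A') F)).
have DmorP A A' F : is_dual_mor (D A) (D A') F (Dmor A A' F).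
  by rewrite /Dmor; case: constructive_indefinite_description.
have Did (A : WQLS k) : Dmor A A (idc A) = idc (D A : QCDG k).
  exact: (is_dual_mor_uniq (DmorP A A _) (is_dual_mor_id (D A))).
have Dcomp (A B C : WQLS k) (G : mor B C) (F : mor A B) :
    Dmor A C (Defs.comp G F) = @Defs.comp (QCDG k) _ _ _ (Dmor A B F) (Dmor B C G).
  apply: (is_dual_mor_uniq (DmorP A C _)).
  exact: (is_dual_mor_comp (DmorP B C G) (DmorP A B F)).
pose DF : @contra_functor (WQLS k) (QCDG k) (fun A => D A) :=
  @ContraFunctor (WQLS k) (QCDG k) (fun A => D A : QCDG k) Dmor Did Dcomp.
exists DF; split=> // A A'.
pose inv (g : cdg_hom (D A') (D A)) :=
  sval (constructive_indefinite_description _ (is_dual_mor_surj g)).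
have invP g : is_dual_mor (D A) (D A') (inv g) g.
  by rewrite /inv; case: constructive_indefinite_description.
exists inv => [F|g].
  exact: (is_dual_mor_inj (invP _) (DmorP A A' F)).
exact: (is_dual_mor_uniq (DmorP A A' _) (invP g)).
Qed.
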